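(* Let $M$ be a compact manifold endowed with a smooth volume form $\omega$, let $f$ be a conservative $C^1$-diffeomorphism of $M$ and let $E\oplus F$, $E\prec F$, be a dominated splitting of $TM$. Then $f_*$ contracts uniformly the volume in $E$ and expands uniformly the volume in $F$.
   Context: A conservative diffeomorphism is a diffeomorphism preserving $\omega$; $f_*$ is the derivative of $f$. Fix a Riemannian metric on $M$. A dominated splitting of $TM$ is an $f_*$-invariant splitting $TM=E\oplus F$, whose fibers have constant dimension and are nonzero, such that there is $n\in\mathbb{N}$ with $\|f_*^n(x)|_E\|\,\|f_*^{-n}(f^n(x))|_F\|<1/2$ for every $x\in M$; one writes $E\prec F$. $f_*$ contracts uniformly the volume in $E$ if there is $\ell\ge1$ such that $|\det(f_*^{\ell}(x)|_E)|<1/2$ for every $x\in M$; $f_*$ expands uniformly the volume in $F$ if there is $\ell\geq 1$ such that $|\det(f_*^{\ell}(x)|_F)|>2$ for every $x\in M$ (determinants taken with respect to the Riemannian metric). *)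

(* Defs.v *)
From HB Require Import structures.
From mathcomp Require Import all_boot all_order all_algebra.
From mathcomp Require Import all_classical all_reals all_analysis.
From mathcomp Require Import ring.
Import Order.TTheory GRing.Theory Num.Theory numFieldNormedType.Exports.

Set Implicit Arguments.
Unset Strict Implicit.
Unset Printing Implicit Defensive.

Local Open Scope classical_set_scope.
Local Open Scope ring_scope.

(* Only used on open sets [U] of finite-dimensional spaces, where asking for
   [C^k] directional derivatives in all directions is the usual [C^(k+1)]. *)
Fixpoint Ck_on (R : realType) (V W : normedModType R) (k : nat) (U : set V)
    (h : V -> W) : Prop :=
  match k with
  | 0 => forall y, U y -> {for y, continuous h}
  | k'.+1 => (forall y, U y -> differentiable h y) /\
             (forall v, Ck_on k' U (fun y => 'D_v h y))
  end.

Definition smooth_on (R : realType) (V W : normedModType R) (U : set V)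
    (h : V -> W) : Prop := forall k, Ck_on k U h.

(* Each [chart i] is a homeomorphism from [chart_dom i] onto an open subset of
   R^d with inverse [chart_inv i]; both are total functions whose values outside
   the domain, respectively the image, are irrelevant. The chart [chart_at x]
   around [x] serves to identify the tangent space at [x] with R^d. *)
Record smooth_manifold (R : realType) (d : nat) := SmoothManifold {
  carrier :> topologicalType;
  chart_index : Type;
  chart_dom : chart_index -> set carrier;
  chart : chart_index -> carrier -> 'rV[R]_d;
  chart_inv : chart_index -> 'rV[R]_d -> carrier;
  chart_at : carrier -> chart_index;
  manifold_hausdorff : hausdorff_space carrier;
  manifold_second_countable : @second_countable carrier;
  chart_dom_open : forall i, open (chart_dom i);
  chart_image_open : forall i, open (chart i @` chart_dom i);
  chartK : forall i x, chart_dom i x -> chart_inv i (chart i x) = x;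
  chart_continuous : forall i x,
    chart_dom i x -> {for x, continuous (chart i)};
  chart_inv_continuous : forall i y,
    (chart i @` chart_dom i) y -> {for y, continuous (chart_inv i)};
  chart_at_dom : forall x, chart_dom (chart_at x) x;
  chart_smooth : forall i j,
    smooth_on (chart i @` (chart_dom i `&` chart_dom j))
              (chart j \o chart_inv i)
}.

(* The derivative of [h] at [x], from the tangent space at [x] to the one at
   [h x], both read as R^d through [chart_at]. *)
Definition tangent_map (R : realType) (d : nat) (M : smooth_manifold R d)
    (h : M -> M) (x : M) : {linear 'rV[R]_d -> 'rV[R]_d} :=
  'd (chart (chart_at (h x)) \o h \o chart_inv (chart_at x))
     (chart (chart_at x) x).

(* The tangent vector at [x] whose coordinates in the chart [i] are [u]. *)
Definition coord_vector (R : realType) (d : nat) (M : smooth_manifold R d)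
    (i : chart_index M) (x : M) (u : 'rV[R]_d) : 'rV[R]_d :=
  'd (chart (chart_at x) \o chart_inv i) (chart i x) u.

Record riemannian_metric (R : realType) (d : nat) (M : smooth_manifold R d) :=
  RiemannianMetric {
  metric :> M -> 'rV[R]_d -> 'rV[R]_d -> R;
  metric_sym : forall x u v, metric x u v = metric x v u;
  metric_linear : forall x a u v w,
    metric x (a *: u + v) w = a * metric x u w + metric x v w;
  metric_pos : forall x u, u != 0 -> 0 < metric x u u;
  metric_smooth : forall (i : chart_index M) (u v : 'rV[R]_d),
    smooth_on (chart i @` chart_dom i)
      (fun y : 'rV[R]_d => let x := chart_inv i y in
        metric x (coord_vector i x u) (coord_vector i x v) : R)
}.

(* A nowhere vanishing smooth differential form of degree d; its arguments at a
   point are the rows of a d x d matrix. *)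
Record volume_form (R : realType) (d : nat) (M : smooth_manifold R d) :=
  VolumeForm {
  vol :> M -> 'M[R]_d -> R;
  vol_multilinear : forall x (A B C : 'M[R]_d) (k : 'I_d) b c,
    row k A = b *: row k B + c *: row k C ->
    row' k B = row' k A -> row' k C = row' k A ->
    vol x A = b * vol x B + c * vol x C;
  vol_alternate : forall x (A : 'M[R]_d) (k l : 'I_d),
    k != l -> row k A = row l A -> vol x A = 0;
  vol_neq0 : forall x, exists A, vol x A != 0;
  vol_smooth : forall (i : chart_index M) (A : 'M[R]_d),
    smooth_on (chart i @` chart_dom i)
      (fun y : 'rV[R]_d => let x := chart_inv i y in
        vol x (\matrix_k coord_vector i x (row k A)) : R)
}.

Definition C1_map (R : realType) (d : nat) (M : smooth_manifold R d)
    (h : M -> M) : Prop :=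
  continuous h /\
  forall i j : chart_index M,
    Ck_on 1 (chart i @` (chart_dom i `&` h @^-1` chart_dom j))
            (chart j \o h \o chart_inv i).

Record C1_diffeo (R : realType) (d : nat) (M : smooth_manifold R d) :=
  C1Diffeo {
  diffeo :> M -> M;
  diffeo_inv : M -> M;
  diffeoK : cancel diffeo diffeo_inv;
  diffeo_invK : cancel diffeo_inv diffeo;
  diffeo_C1 : C1_map diffeo;
  diffeo_inv_C1 : C1_map diffeo_inv
}.

Definition conservative (R : realType) (d : nat) (M : smooth_manifold R d)
    (omega : volume_form M) (f : C1_diffeo M) : Prop :=
  forall x (A : 'M[R]_d),
    omega (f x) (\matrix_k tangent_map f x (row k A)) = omega x A.

Definition tangent_norm (R : realType) (d : nat) (M : smooth_manifold R d)
    (g : riemannian_metric M) (x : M) (u : 'rV[R]_d) : R :=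
  Num.sqrt (g x u u).

(* Operator norm of the restriction to [E] of the derivative of [h] at [x]. *)
Definition restr_norm (R : realType) (d : nat) (M : smooth_manifold R d)
    (g : riemannian_metric M) (h : M -> M) (x : M) (E : {vspace 'rV[R]_d}) : R :=
  sup [set tangent_norm g (h x) (tangent_map h x u) |
       u in [set u | u \in E /\ tangent_norm g x u <= 1]].

Definition gram (R : realType) (d : nat) (M : smooth_manifold R d)
    (g : riemannian_metric M) (x : M) (k : nat) (b : k.-tuple 'rV[R]_d) : R :=
  \det (\matrix_(i < k, j < k) g x (tnth b i) (tnth b j)).

(* Absolute value of the determinant of the restriction to [E] of the derivative
   of [h] at [x], as a map onto its image: the Riemannian volume of the
   parallelepiped spanned by the image of a basis of [E], over that of the basis.
   See [restr_absdet_orthonormal] for its value in orthonormal bases. *)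
Definition restr_absdet (R : realType) (d : nat) (M : smooth_manifold R d)
    (g : riemannian_metric M) (h : M -> M) (x : M) (E : {vspace 'rV[R]_d}) : R :=
  Num.sqrt (gram g (h x) (map_tuple (tangent_map h x) (vbasis E)))
  / Num.sqrt (gram g x (vbasis E)).

(* [E] is the dominated bundle: E < F. *)
Definition dominated_splitting (R : realType) (d : nat)
    (M : smooth_manifold R d) (g : riemannian_metric M) (f : C1_diffeo M)
    (E F : M -> {vspace 'rV[R]_d}) : Prop :=
  [/\ forall x, (E x + F x)%VS = fullv /\ (E x :&: F x)%VS = 0%VS,
      exists p q : nat, [/\ (0 < p)%N, (0 < q)%N &
        forall x, \dim (E x) = p /\ \dim (F x) = q],
      forall x, (linfun (tangent_map f x) @: E x)%VS = E (f x) /\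
                (linfun (tangent_map f x) @: F x)%VS = F (f x) &
      exists n : nat, forall x,
        restr_norm g (iter n f) x (E x)
        * restr_norm g (iter n (diffeo_inv f)) (iter n f x) (F (iter n f x))
        < 1 / 2].

Definition contracts_volume (R : realType) (d : nat) (M : smooth_manifold R d)
    (g : riemannian_metric M) (f : C1_diffeo M)
    (E : M -> {vspace 'rV[R]_d}) : Prop :=
  exists2 l : nat, (1 <= l)%N &
    forall x, restr_absdet g (iter l f) x (E x) < 1 / 2.

Definition expands_volume (R : realType) (d : nat) (M : smooth_manifold R d)
    (g : riemannian_metric M) (f : C1_diffeo M)
    (F : M -> {vspace 'rV[R]_d}) : Prop :=
  exists2 l : nat, (1 <= l)%N &
    forall x, 2 < restr_absdet g (iter l f) x (F x).

Lemma metric_suml (R : realType) (d : nat) (M : smooth_manifold R d)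
    (g : riemannian_metric M) (x : M) (k : nat) (a : 'I_k -> R)
    (u : 'I_k -> 'rV[R]_d) (v : 'rV[R]_d) :
  g x (\sum_i a i *: u i) v = \sum_i a i * g x (u i) v.
Proof.
have g0 : g x 0 v = 0.
  have := metric_linear g x 1 0 0 v.
  rewrite scaler0 addr0 mul1r => /esym /eqP; rewrite -subr_eq0 addrK => /eqP.
  exact.
elim/big_rec2: _ => [//|i s t _ IH].
by rewrite metric_linear IH.
Qed.

Lemma metric_mx_change (R : realType) (d : nat) (M : smooth_manifold R d)
    (g : riemannian_metric M) (x : M) (k : nat) (P Q : 'M[R]_k)
    (u v : 'I_k -> 'rV[R]_d) :
  \matrix_(i < k, j < k)
     g x (\sum_l P i l *: u l) (\sum_l Q j l *: v l)
  = P *m (\matrix_(i < k, j < k) g x (u i) (v j)) *m Q^T.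
Proof.
apply/matrixP => i j; rewrite !mxE metric_suml.
under eq_bigr do rewrite metric_sym metric_suml mulr_sumr.
rewrite exchange_big /=; apply: eq_bigr => m _.
rewrite !mxE mulr_suml; apply: eq_bigr => l _.
by rewrite mxE (metric_sym g x (u l)) mulrA mulrAC.
Qed.

Lemma restr_absdet_orthonormal (R : realType) (d : nat)
    (M : smooth_manifold R d) (g : riemannian_metric M) (h : M -> M) (x : M)
    (E E' : {vspace 'rV[R]_d})
    (e e' : (\dim E).-tuple 'rV[R]_d) :
  basis_of E e -> basis_of E' e' ->
  (forall i j, g x (tnth e i) (tnth e j) = (i == j)%:R) ->
  (forall i j, g (h x) (tnth e' i) (tnth e' j) = (i == j)%:R) ->
  (linfun (tangent_map h x) @: E <= E')%VS ->
  restr_absdet g h x E =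
  `|\det (\matrix_(i < \dim E, j < \dim E)
       g (h x) (tangent_map h x (tnth e i)) (tnth e' j))|.
Proof.
move=> eE eE' oe oe' TE.
set T := tangent_map h x.
set b := vbasis E.
have bE i : tnth b i \in E by apply: vbasis_mem; exact: mem_tnth.
have eiE i : tnth e i \in E by apply: (basis_mem eE); exact: mem_tnth.
pose P := \matrix_(i < \dim E, j < \dim E) coord e j (tnth b i).
pose P' := \matrix_(i < \dim E, j < \dim E) coord b j (tnth e i).
have bP i : tnth b i = \sum_j P i j *: tnth e j.
  rewrite {1}(coord_basis eE (bE i)).
  by apply: eq_bigr => j _; rewrite mxE -tnth_nth.
have Tb i : T (tnth b i) = \sum_j P i j *: T (tnth e j).
  by rewrite bP linear_sum; apply: eq_bigr => j _; rewrite linearZ.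
pose C := \matrix_(i < \dim E, j < \dim E) coord e' j (T (tnth e i)).
have TeC i : T (tnth e i) = \sum_j C i j *: tnth e' j.
  have Te' : T (tnth e i) \in E'.
    by apply: (subvP TE); rewrite -[T _]lfunE; exact: memv_img.
  rewrite {1}(coord_basis eE' Te').
  by apply: eq_bigr => j _; rewrite mxE -tnth_nth.
have G1 : \matrix_(i < \dim E, j < \dim E) g x (tnth e i) (tnth e j) = 1%:M.
  by apply/matrixP => i j; rewrite !mxE oe.
have G1' : \matrix_(i < \dim E, j < \dim E)
    g (h x) (tnth e' i) (tnth e' j) = 1%:M.
  by apply/matrixP => i j; rewrite !mxE oe'.
have -> : \matrix_(i < \dim E, j < \dim E)
    g (h x) (T (tnth e i)) (tnth e' j) = C.
  transitivity (C *m 1%:M *m (1%:M)^T); last by rewrite trmx1 !mulmx1.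
  rewrite -{1}G1' -(metric_mx_change _ _ _ _ (tnth _) (tnth _)).
  apply/matrixP => i j; rewrite !mxE TeC; congr (g _ _ _).
  rewrite (bigD1 j) //= big1 ?addr0 ?mxE ?eqxx ?scale1r // => l lj.
  by rewrite mxE eq_sym (negPf lj) scale0r.
have gb : gram g x b = \det P ^+ 2.
  transitivity (\det (P *m 1%:M *m P^T)); last first.
    by rewrite mulmx1 det_mulmx det_tr expr2.
  rewrite -G1 -(metric_mx_change _ _ _ _ (tnth _) (tnth _)) /gram.
  congr (\det _).
  by apply/matrixP => i j; rewrite !mxE -!bP.
have G2 : \matrix_(i < \dim E, j < \dim E)
    g (h x) (T (tnth e i)) (T (tnth e j)) = C *m C^T.
  transitivity (C *m 1%:M *m C^T); last by rewrite mulmx1.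
  rewrite -G1' -(metric_mx_change _ _ _ _ (tnth _) (tnth _)).
  by apply/matrixP => i j; rewrite !mxE -!TeC.
have gTb : gram g (h x) (map_tuple T b) = (\det P * \det C) ^+ 2.
  transitivity (\det (P *m (C *m C^T) *m P^T)); last first.
    by rewrite !det_mulmx !det_tr; ring.
  rewrite -G2 -(metric_mx_change _ _ _ _ (T \o tnth e) (T \o tnth e)) /gram.
  congr (\det _); apply/matrixP => i j.
  by rewrite !mxE !tnth_map !Tb.
have PP' : P' *m P = 1%:M.
  apply/matrixP => i j; rewrite !mxE.
  have : tnth e i = \sum_j0 (P' *m P) i j0 *: tnth e j0.
    rewrite {1}(coord_basis (vbasisP E) (eiE i)).
    under [RHS]eq_bigr do rewrite mxE scaler_suml.
    rewrite exchange_big /=; apply: eq_bigr => l _.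
    rewrite -tnth_nth bP scaler_sumr; apply: eq_bigr => m _.
    by rewrite scalerA !mxE.
  move=> /(congr1 (fun u => g x u (tnth e j))).
  rewrite metric_suml oe (bigD1 j) //= big1 ?addr0; last first.
    by move=> l lj; rewrite oe (negPf lj) mulr0.
  by rewrite oe eqxx mulr1 mxE => ->.
have dP : `|\det P| != 0.
  rewrite normr_eq0; apply/eqP => P0.
  have := congr1 determinant PP'.
  by rewrite det_mulmx P0 mulr0 det1 => /eqP; rewrite eq_sym oner_eq0.
rewrite /restr_absdet -/T -/b gb gTb !sqrtr_sqr normrM mulrAC divff //.
by rewrite mul1r.
Qed.

(* Main.v *)
From mathcomp Require Import all_boot all_order all_algebra all_fingroup.
From mathcomp Require Import all_classical all_reals all_analysis.
From mathcomp Require Import ring lra.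
Require Import Defs.
Import Order.TTheory GRing.Theory Num.Theory numFieldNormedType.Exports.

(** Why the volume is contracted along E and expanded along F.

    Compare g-orthonormal bases of E and F at x with such bases at f^N x. The
    derivative of f^N has in these bases a block diagonal matrix with blocks of
    absolute determinants X (along E) and Y (along F), and f^N preserves omega.
    Hence X * Y is the quotient of the omega-volumes of the two bases of the
    whole tangent space. These volumes are bounded above and below, uniformly
    in the base point, for two reasons. The absolute density of omega with
    respect to g is continuous and positive on a compact manifold
    ([compact_density_bounds]). And E and F are uniformly transverse: if u in
    E and v in F nearly cancelled, then so would their images by f^n, since
    both f^n and its inverse have bounded derivatives
    ([iter_tangent_bound]); but domination makes the image of v about twice as
    long as that of u, too long to be cancelled
    ([transverse_of_domination]). So X * Y lies between 1 / L and L, with L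
    independent of x and N ([dominated_absdet_product]).

    On the other hand, if f^N stretches E by at most a and F by at least
    1 / b, then X <= p! a^p and 1 <= q! b^q Y
    ([dominated_volume_bounds]). For N = n k the domination iterates to
    a b <= 2^-k, so that
    X^(p+q) = X^q X^p <= (p!)^q a^(pq) X^p (q! b^q Y)^p <= const * 2^-k
    ([domination_volume_bound]). Thus X tends to 0 uniformly in x, and then Y,
    being at least 1 / (L X), tends to infinity uniformly.

    Only finiteness and uniformity of the constants matter, which is why
    determinants are estimated by n! times a power of the largest entry. *)

Set Implicit Arguments.
Unset Strict Implicit.
Unset Printing Implicit Defensive.

Local Open Scope classical_set_scope.
Local Open Scope ring_scope.

(** * Determinants and alternating forms *)

Lemma det_le_fact (R : realType) (n : nat) (A : 'M[R]_n) (c : R) :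
  (forall i j, `|A i j| <= c) -> `|\det A| <= n`!%:R * c ^+ n.
Proof.
move=> Ac; rewrite /determinant (le_trans (ler_norm_sum _ _ _)) //.
apply: (@le_trans _ _ (\sum_(s : 'S_n) c ^+ n)).
  apply: ler_sum => s _; rewrite normrM normrX normrN1 expr1n mul1r normr_prod.
  rewrite -[n in c ^+ n]card_ord -prodr_const; apply: ler_prod => i _.
  by rewrite normr_ge0 Ac.
by rewrite sumr_const card_Sn mulr_natl.
Qed.

(** An alternating multilinear function of the rows is a multiple of the
    determinant: this makes a volume form transform by the determinant. *)
Section AlternatingForm.
Context {R : realType} {n : nat} (phi : 'M[R]_n -> R).
Hypothesis phi_multilinear : forall (A B C : 'M[R]_n) (k : 'I_n) b c,
  row k A = b *: row k B + c *: row k C ->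
  row' k B = row' k A -> row' k C = row' k A ->
  phi A = b * phi B + c * phi C.
Hypothesis phi_alternate : forall (A : 'M[R]_n) (k l : 'I_n),
  k != l -> row k A = row l A -> phi A = 0.

Let set_row (A : 'M[R]_n) k (r : 'rV[R]_n) : 'M[R]_n :=
  \matrix_(i, j) if i == k then r 0 j else A i j.

Let row_set_row A k r : row k (set_row A k r) = r.
Proof. by apply/rowP=> j; rewrite !mxE eqxx. Qed.

Let row'_set_row A k r : row' k (set_row A k r) = row' k A.
Proof. by apply/matrixP=> i j; rewrite !mxE eq_sym (negPf (neq_lift _ _)). Qed.

Let set_row_id A k : set_row A k (row k A) = A.
Proof. by apply/matrixP=> i j; rewrite !mxE; case: eqP => [->|]. Qed.

Let row_set_row_neq A k l r : l != k -> row l (set_row A k r) = row l A.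
Proof. by move=> lk; apply/rowP=> j; rewrite !mxE (negPf lk). Qed.

Let phi_set_rowD A k u v :
  phi (set_row A k (u + v)) = phi (set_row A k u) + phi (set_row A k v).
Proof.
rewrite (@phi_multilinear _ (set_row A k u) (set_row A k v) k 1 1) ?mul1r //.
- by rewrite !row_set_row !scale1r.
- by rewrite !row'_set_row.
- by rewrite !row'_set_row.
Qed.

Let phi_set_row_sum A k (I : Type) (r : seq I) (a : I -> R) u :
  phi (set_row A k (\sum_(i <- r) a i *: u i)) =
  \sum_(i <- r) a i * phi (set_row A k (u i)).
Proof.
elim: r => [|i r IH].
  rewrite !big_nil (@phi_multilinear (set_row A k 0) A A k 0 0).
  - by rewrite !mul0r addr0.
  - by rewrite row_set_row !scale0r addr0.
  - by rewrite row'_set_row.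
  - by rewrite row'_set_row.
rewrite !big_cons -IH.
rewrite (@phi_multilinear _ (set_row A k (u i))
  (set_row A k (\sum_(j <- r) a j *: u j)) k (a i) 1) ?mul1r //.
- by rewrite !row_set_row scale1r.
- by rewrite !row'_set_row.
- by rewrite !row'_set_row.
Qed.

Let phi_xrow A k l : k != l -> phi (xrow k l A) = - phi A.
Proof.
move=> kl; have lk : l != k by rewrite eq_sym.
(* B u v is A with rows k and l replaced by u and v. *)
pose B u v := set_row (set_row A k u) l v.
have comm u v : B u v = set_row (set_row A l v) k u.
  apply/matrixP => i j; rewrite !mxE.
  by have [->|//] := eqVneq i l; rewrite (negPf lk).
have B0 u : phi (B u u) = 0.
  apply: (phi_alternate kl).
  by rewrite row_set_row comm row_set_row.
pose u := row k A; pose v := row l A.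
have BA : B u v = A.
  by rewrite comm /v set_row_id set_row_id.
have BxA : B v u = xrow k l A.
  apply/matrixP => i j; rewrite !mxE.
  have [->|il] := eqVneq i l; first by rewrite tpermR.
  have [->|ik] := eqVneq i k; first by rewrite tpermL.
  by rewrite tpermD // eq_sym.
have := B0 (u + v).
rewrite {1}/B phi_set_rowD -![set_row (set_row _ _ (_ + _)) _ _]/(B _ _).
rewrite !comm !phi_set_rowD -!comm !B0 add0r addr0 BA BxA.
by move=> /eqP; rewrite addr_eq0 => /eqP.
Qed.

Let phi_perm (s : 'S_n) : phi (perm_mx s) = (-1) ^+ s * phi 1%:M.
Proof.
have [ts -> all_ts] := prod_tpermP s.
elim: ts all_ts => [|t ts IH] /=.
  by rewrite big_nil perm_mx1 odd_perm1 mul1r.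
move=> /andP[tP tsP]; rewrite big_cons perm_mxM -/(tperm_mx t.1 t.2) -xrowE.
rewrite phi_xrow // IH // odd_permM odd_tperm tP signr_addb.
by rewrite expr1 mulN1r mulNr.
Qed.

Lemma alternating_form_det (A : 'M[R]_n) : phi A = \det A * phi 1%:M.
Proof.
(* Expand one row at a time along the standard basis, until all rows belong to
   it: the matrix is then a permutation matrix or has two equal rows. *)
pose Q m := forall A : 'M[R]_n,
  (forall i : 'I_n, (m <= i)%N -> exists c, row i A = delta_mx 0 c) ->
  phi A = \det A * phi 1%:M.
suff Qm m : Q m by apply: (Qm n) => i; rewrite leqNgt ltn_ord.
elim: m => [|m IH] B BP.
  have /boolp.choice[s sP] : forall i : 'I_n, exists c, row i B = delta_mx 0 c.
    by move=> i; apply: BP.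
  have [/injectiveP s_inj|/injectivePn[i [j ij sij]]] := boolP (injectiveb s).
    have -> : B = perm_mx (perm s_inj).
      apply/row_matrixP => i; rewrite sP; apply/rowP => j.
      by rewrite !mxE permE /= [s i == j]eq_sym.
    by rewrite phi_perm det_perm.
  have rij : row i B = row j B by rewrite !sP sij.
  rewrite (phi_alternate ij rij) (determinant_alternate ij) ?mul0r //.
  by move=> k; have := congr1 (fun r : 'rV_n => r 0 k) rij; rewrite !mxE.
have [nm|mn] := leqP n m.
  by apply: IH => i mi; have := leq_trans nm mi; rewrite leqNgt ltn_ord.
pose k := Ordinal mn.
have rB : row k B = \sum_c B k c *: delta_mx 0 c.
  by rewrite {1}(row_sum_delta (row k B)); apply: eq_bigr => c _; rewrite mxE.
have QB c : phi (set_row B k (delta_mx 0 c)) =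
    \det (set_row B k (delta_mx 0 c)) * phi 1%:M.
  apply: IH => i mi; have [->|ik] := eqVneq i k.
    by rewrite row_set_row; exists c.
  rewrite row_set_row_neq //; apply: BP.
  rewrite ltn_neqAle mi andbT.
  by apply: contra ik => /eqP mi'; apply/eqP/val_inj.
rewrite -[B in LHS](set_row_id B k) rB phi_set_row_sum.
under eq_bigr do rewrite QB mulrA.
rewrite -mulr_suml; congr (_ * _).
rewrite (expand_det_row B k); apply: eq_bigr => c _; congr (_ * _).
rewrite (expand_det_row _ k) (bigD1 c) //= big1 ?addr0; last first.
  by move=> c' cc'; rewrite !mxE eqxx (negPf cc') mul0r.
rewrite !mxE !eqxx mul1r /cofactor; congr (_ * \det _).
by apply/matrixP => i j; rewrite !mxE eq_sym (negPf (neq_lift _ _)).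
Qed.

Lemma alternating_form_mulmx (A B : 'M[R]_n) : phi (A *m B) = \det A * phi B.
Proof.
by rewrite alternating_form_det det_mulmx -mulrA -alternating_form_det.
Qed.

End AlternatingForm.

(** * Inner products and orthonormal bases *)

Record inner_product (R : realType) (d : nat) := InnerProduct {
  ip :> 'rV[R]_d -> 'rV[R]_d -> R;
  ip_sym : forall u v, ip u v = ip v u;
  ip_linear : forall a u v w, ip (a *: u + v) w = a * ip u w + ip v w;
  ip_pos : forall u, u != 0 -> 0 < ip u u
}.

Definition ipnorm (R : realType) (d : nat) (s : inner_product R d)
  (u : 'rV[R]_d) : R := Num.sqrt (s u u).

Definition orthonormal (R : realType) (d k : nat) (s : inner_product R d)
    (b : k.-tuple 'rV[R]_d) : Prop :=
  forall i j, s (tnth b i) (tnth b j) = (i == j)%:R.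

Section InnerProduct.
Context {R : realType} {d : nat} (s : inner_product R d).
Implicit Types (u v w : 'rV[R]_d) (U : {vspace 'rV[R]_d}).

Lemma ip0l v : s 0 v = 0.
Proof.
have := ip_linear s 1 0 0 v.
by rewrite scaler0 addr0 mul1r => /esym /eqP; rewrite -subr_eq0 addrK => /eqP.
Qed.

Lemma ipDl u v w : s (u + v) w = s u w + s v w.
Proof. by rewrite -[u in LHS]scale1r ip_linear mul1r. Qed.

Lemma ipZl a u w : s (a *: u) w = a * s u w.
Proof. by rewrite -[_ *: _]addr0 ip_linear ip0l addr0. Qed.

Lemma ipDr u v w : s w (u + v) = s w u + s w v.
Proof. by rewrite ip_sym ipDl !(ip_sym s w). Qed.

Lemma ipZr a u w : s w (a *: u) = a * s w u.
Proof. by rewrite ip_sym ipZl (ip_sym s w). Qed.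

Lemma ip_suml (I : Type) (r : seq I) (a : I -> R) (u : I -> 'rV[R]_d) v :
  s (\sum_(i <- r) a i *: u i) v = \sum_(i <- r) a i * s (u i) v.
Proof.
elim: r => [|i r IH]; first by rewrite !big_nil ip0l.
by rewrite !big_cons ip_linear IH.
Qed.

Lemma ip_sumr (I : Type) (r : seq I) (a : I -> R) (u : I -> 'rV[R]_d) v :
  s v (\sum_(i <- r) a i *: u i) = \sum_(i <- r) a i * s v (u i).
Proof. by rewrite ip_sym ip_suml; apply: eq_bigr => i _; rewrite ip_sym. Qed.

Lemma ip_ge0 u : 0 <= s u u.
Proof. by have [->|/(ip_pos s)/ltW//] := eqVneq u 0; rewrite ip0l. Qed.

Lemma ipnorm_ge0 u : 0 <= ipnorm s u.
Proof. exact: sqrtr_ge0. Qed.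

Lemma ipnormE u : ipnorm s u ^+ 2 = s u u.
Proof. by rewrite sqr_sqrtr ?ip_ge0. Qed.

Lemma ipnorm_gt0 u : u != 0 -> 0 < ipnorm s u.
Proof. by move=> u0; rewrite sqrtr_gt0 ip_pos. Qed.

Lemma ipnorm0 : ipnorm s 0 = 0.
Proof. by rewrite /ipnorm ip0l sqrtr0. Qed.

Lemma ipnormZ a u : ipnorm s (a *: u) = `|a| * ipnorm s u.
Proof.
by rewrite /ipnorm ipZl ipZr mulrA -expr2 sqrtrM ?sqr_ge0 // sqrtr_sqr.
Qed.

Lemma cauchy_schwarz u v : `|s u v| <= ipnorm s u * ipnorm s v.
Proof.
rewrite -ler_sqr ?nnegrE ?mulr_ge0 ?ipnorm_ge0 // real_normK ?num_real //.
rewrite exprMn !ipnormE.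
have [->|v0] := eqVneq v 0; first by rewrite ip_sym !ip0l expr0n mulr0.
have vv := ip_pos s v0.
(* This vector is |v|^2 times the component of u orthogonal to v. *)
have := ip_ge0 (s v v *: u + (- s u v) *: v).
rewrite !ipDl !ipDr !ipZl !ipZr (ip_sym s v u).
set a := s u u; set b := s u v; set c := s v v in vv *.
rewrite [X in 0 <= X -> _](_ : _ = c * (a * c - b ^+ 2)); last by ring.
by rewrite pmulr_rge0 // subr_ge0.
Qed.

Lemma ipnorm_triangle u v : ipnorm s (u + v) <= ipnorm s u + ipnorm s v.
Proof.
rewrite -ler_sqr ?nnegrE ?addr_ge0 ?ipnorm_ge0 // sqrrD !ipnormE.
rewrite ipDl !ipDr (ip_sym s v u).
have := le_trans (ler_norm _) (cauchy_schwarz u v); lra.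
Qed.

Lemma ipnorm_sum (I : Type) (r : seq I) (u : I -> 'rV[R]_d) :
  ipnorm s (\sum_(i <- r) u i) <= \sum_(i <- r) ipnorm s (u i).
Proof.
elim: r => [|i r IH]; first by rewrite !big_nil ipnorm0.
by rewrite !big_cons (le_trans (ipnorm_triangle _ _)) // lerD2l.
Qed.

Lemma orthonormal_norm k (b : k.-tuple 'rV[R]_d) i :
  orthonormal s b -> ipnorm s (tnth b i) = 1.
Proof. by move=> sb; rewrite /ipnorm sb eqxx sqrtr1. Qed.

Lemma orthonormal_coef k (b : k.-tuple 'rV[R]_d) (a : 'I_k -> R) j :
  orthonormal s b -> s (\sum_i a i *: tnth b i) (tnth b j) = a j.
Proof.
move=> sb; rewrite ip_suml (bigD1 j) //= sb eqxx mulr1 big1 ?addr0 // => i ij.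
by rewrite sb (negPf ij) mulr0.
Qed.

Lemma orthonormal_free k (b : k.-tuple 'rV[R]_d) : orthonormal s b -> free b.
Proof.
move=> sb; apply/freeP => a a0 i.
rewrite -(orthonormal_coef a i sb) -(ip0l (tnth b i)) -[X in _ = s X _]a0.
by congr (s _ _); apply: eq_bigr => j _; rewrite (tnth_nth 0).
Qed.

(** Stating the conclusion for the span of an arbitrary list makes the
    orthogonalization step a plain induction on that list. *)
Lemma gram_schmidt (X : seq 'rV[R]_d) :
  exists k (b : k.-tuple 'rV[R]_d), orthonormal s b /\ <<b>>%VS = <<X>>%VS.
Proof.
elim: X => [|x X [k [b [sb bX]]]].
  by exists 0%N, [tuple]; split => // -[].
pose y := \sum_i s x (tnth b i) *: tnth b i; pose r := x - y.
have yb : y \in <<b>>%VS.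
  by apply: memv_suml => i _; rewrite memvZ // memv_span // mem_tnth.
have rb i : s r (tnth b i) = 0.
  by rewrite ipDl -scaleN1r ipZl orthonormal_coef // mulN1r subrr.
have [r0|r0] := eqVneq r 0.
  exists k, b; split => //; rewrite span_cons bX; apply/esym/addv_idPr.
  by rewrite -memvE -bX; move/eqP: r0; rewrite subr_eq0 => /eqP ->.
have nr := ipnorm_gt0 r0.
pose e := (ipnorm s r)^-1 *: r.
exists k.+1, [tuple of e :: b]; split.
  have ee : s e e = 1.
    by rewrite ipZl ipZr -ipnormE expr2 mulKf ?mulVf // gt_eqF.
  have eb j : s e (tnth b j) = 0 by rewrite ipZl rb mulr0.
  move=> i j; case: (unliftP ord0 i) => [i'|] ->;
    case: (unliftP ord0 j) => [j'|] ->.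
  - by rewrite !tnthS sb (inj_eq lift_inj).
  - by rewrite tnthS tnth0 ip_sym eb eq_sym (negPf (neq_lift _ _)).
  - by rewrite tnthS tnth0 eb (negPf (neq_lift _ _)).
  - by rewrite !tnth0 ee eqxx.
have eE : (<[e]> = <[r]>)%VS.
  apply/eqP; rewrite eqEsubv; apply/andP; split.
    by rewrite -memvE memvZ // memv_line.
  rewrite -memvE; have -> : r = ipnorm s r *: e.
    by rewrite scalerA mulfV ?scale1r // gt_eqF.
  by rewrite memvZ // memv_line.
rewrite !span_cons eE bX; apply/eqP; rewrite eqEsubv !subv_add !addvSr !andbT.
rewrite -!memvE; apply/andP; split.
  by rewrite memv_add ?memv_line // memvN -bX.
rewrite -[x](subrK y); apply: memv_add; first exact: memv_line.
by rewrite -bX.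
Qed.

Lemma orthonormal_basis_exists U k : \dim U = k ->
  exists b : k.-tuple 'rV[R]_d, basis_of U b /\ orthonormal s b.
Proof.
move=> Uk; have [m [b [sb bU]]] := gram_schmidt (vbasis U).
have bas : basis_of U b.
  apply/andP; split; last exact: orthonormal_free sb.
  by rewrite bU (span_basis (vbasisP U)).
have mk : m = k by rewrite -Uk (size_basis bas).
by move: b sb bas {bU}; rewrite mk => b sb bas; exists b.
Qed.

Lemma orthonormal_expand U k (b : k.-tuple 'rV[R]_d) u :
  basis_of U b -> orthonormal s b -> u \in U ->
  u = \sum_i s u (tnth b i) *: tnth b i.
Proof.
move=> bU sb uU; have ub := coord_basis bU uU.
have {}ub : u = \sum_i coord b i u *: tnth b i.
  by rewrite {1}ub; apply: eq_bigr => i _; rewrite (tnth_nth 0).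
rewrite {1}ub; apply: eq_bigr => i _; congr (_ *: _).
by rewrite {2}ub orthonormal_coef.
Qed.

Lemma orthonormal_coef_le k (b : k.-tuple 'rV[R]_d) u i :
  orthonormal s b -> `|s u (tnth b i)| <= ipnorm s u.
Proof.
move=> sb; rewrite -[leRHS]mulr1 -(orthonormal_norm i sb).
exact: cauchy_schwarz.
Qed.

End InnerProduct.

(** * Frames and Gram matrices *)

Definition gram_mx (R : realType) (d m n : nat) (s : inner_product R d)
    (A : 'M[R]_(m, d)) (B : 'M[R]_(n, d)) : 'M[R]_(m, n) :=
  \matrix_(i, j) s (row i A) (row j B).

Definition frame (R : realType) (d k : nat) (b : k.-tuple 'rV[R]_d) :
  'M[R]_(k, d) := \matrix_i tnth b i.

Section Frames.
Context {R : realType} {d : nat} (s : inner_product R d).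

Lemma gram_mx_mul m n k l (P : 'M[R]_(m, k)) (Q : 'M[R]_(n, l)) A B :
  gram_mx s (P *m A) (Q *m B) = P *m gram_mx s A B *m Q^T.
Proof.
apply/matrixP => i j; rewrite !mxE !row_mul !mulmx_sum_row ip_sumr.
apply: eq_bigr => b _; rewrite ip_suml !mxE mulrC; congr (_ * _).
by apply: eq_bigr => a _; rewrite !mxE.
Qed.

Lemma gram_mx_mulVr m n k (P : 'M[R]_(m, k)) (A : 'M[R]_(k, d))
  (B : 'M[R]_(n, d)) : gram_mx s (P *m A) B = P *m gram_mx s A B.
Proof. by rewrite -{1}(mul1mx B) gram_mx_mul trmx1 mulmx1. Qed.

Lemma gram_mx_orthonormal k (b : k.-tuple 'rV[R]_d) :
  orthonormal s b -> gram_mx s (frame b) (frame b) = 1%:M.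
Proof. by move=> sb; apply/matrixP => i j; rewrite !mxE !rowK sb. Qed.

Lemma orthonormal_basis_fullv (b : d.-tuple 'rV[R]_d) :
  orthonormal s b -> basis_of fullv b.
Proof.
move=> /orthonormal_free fb; rewrite basisEfree fb subvf size_tuple dimvf.
by rewrite dim_matrix mul1r leqnn.
Qed.

Lemma orthonormal_frame_exists :
  exists b : d.-tuple 'rV[R]_d, orthonormal s b.
Proof.
have [|b [_ sb]] := @orthonormal_basis_exists R d s fullv d; last by exists b.
by rewrite dimvf dim_matrix mul1r.
Qed.

Lemma frame_expand m (A : 'M[R]_(m, d)) (b : d.-tuple 'rV[R]_d) :
  orthonormal s b -> A = gram_mx s A (frame b) *m frame b.
Proof.
move=> sb; apply/row_matrixP => i; rewrite row_mul mulmx_sum_row.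
rewrite (orthonormal_expand (orthonormal_basis_fullv sb) sb (memvf (row i A))).
by apply: eq_bigr => j _; rewrite !mxE !rowK.
Qed.

(** A linear map on an inner product space is bounded by the sum of the lengths
    of the images of an orthonormal basis, since coordinates in such a basis
    are at most the norm. *)
Lemma ipnorm_linear_le (s' : inner_product R d)
    (T : {linear 'rV[R]_d -> 'rV[R]_d}) (b : d.-tuple 'rV[R]_d) u :
  orthonormal s b ->
  ipnorm s' (T u) <= (\sum_i ipnorm s' (T (tnth b i))) * ipnorm s u.
Proof.
move=> sb.
rewrite {1}(orthonormal_expand (orthonormal_basis_fullv sb) sb (memvf u)).
rewrite linear_sum (le_trans (ipnorm_sum _ _ _)) // mulr_suml.
apply: ler_sum => i _; rewrite linearZ ipnormZ mulrC.
by rewrite ler_wpM2l ?ipnorm_ge0 ?orthonormal_coef_le.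
Qed.

End Frames.

(** The entries of the matrix are at most a, by Cauchy-Schwarz. *)
Lemma orthonormal_det_le (R : realType) (d k : nat) (s s' : inner_product R d)
    (T : {linear 'rV[R]_d -> 'rV[R]_d}) (b b' : k.-tuple 'rV[R]_d) (a : R) :
  orthonormal s b -> orthonormal s' b' ->
  (forall i, ipnorm s' (T (tnth b i)) <= a * ipnorm s (tnth b i)) ->
  `|\det (\matrix_(i < k, j < k) s' (T (tnth b i)) (tnth b' j))|
    <= k`!%:R * a ^+ k.
Proof.
move=> sb sb' Ta; apply: det_le_fact => i j; rewrite mxE.
rewrite (le_trans (orthonormal_coef_le _ _ sb')) //.
by rewrite (le_trans (Ta i)) // orthonormal_norm ?mulr1.
Qed.

(** The matrix of the inverse map has entries at most a. *)
Lemma orthonormal_det_ge (R : realType) (d k : nat) (s s' : inner_product R d)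
    (T : {linear 'rV[R]_d -> 'rV[R]_d}) (U U' : {vspace 'rV[R]_d})
    (b b' : k.-tuple 'rV[R]_d) (a : R) :
  basis_of U b -> basis_of U' b' -> orthonormal s b -> orthonormal s' b' ->
  (forall v, v \in U' -> exists2 u, u \in U & T u = v) ->
  0 <= a -> (forall u, u \in U -> ipnorm s u <= a * ipnorm s' (T u)) ->
  1 <= k`!%:R * a ^+ k *
    `|\det (\matrix_(i < k, j < k) s' (T (tnth b i)) (tnth b' j))|.
Proof.
move=> bU bU' sb sb' T_onto a0 Ta.
have /boolp.choice[w wP] : forall j, exists u, u \in U /\ T u = tnth b' j.
  move=> j; have [|u uU Tu] := T_onto (tnth b' j); last by exists u.
  by apply: (basis_mem bU'); exact: mem_tnth.
set D := \matrix_(i, j) _.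
pose B : 'M[R]_k := \matrix_(i, j) s (w i) (tnth b j).
have BD : B *m D = 1%:M.
  apply/matrixP => i j; rewrite !mxE -(sb' i j) -(wP i).2.
  rewrite [in RHS](orthonormal_expand bU sb (wP i).1) linear_sum.
  under [X in s' X]eq_bigr do rewrite linearZ.
  by rewrite ip_suml; apply: eq_bigr => l _; rewrite !mxE.
have Ble : `|\det B| <= k`!%:R * a ^+ k.
  apply: det_le_fact => i j; rewrite mxE.
  rewrite (le_trans (orthonormal_coef_le _ _ sb)) //.
  by rewrite (le_trans (Ta _ (wP i).1)) // (wP i).2 orthonormal_norm ?mulr1.
have BD1 : `|\det B| * `|\det D| = 1.
  by rewrite -normrM -det_mulmx BD det1 normr1.
rewrite -[leLHS]BD1.
by rewrite ler_wpM2r.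
Qed.

(** * Splittings of an inner product space *)

Section Splitting.
Context {R : realType} {p q : nat}.
Implicit Types (s : inner_product R (p + q)) (E F : {vspace 'rV[R]_(p + q)}).

(** When E and F are transverse with constant K, the frame made of orthonormal
    bases of E and F has a volume comparable to that of an orthonormal frame:
    its transition matrix has entries at most 1, and the inverse transition
    matrix has entries at most K, being made of the coordinates of the E- and
    F-components of unit vectors. *)
Lemma splitting_frame_bounds s E F (K : R) (e : p.-tuple 'rV[R]_(p + q))
    (h : q.-tuple 'rV[R]_(p + q)) (w : (p + q).-tuple 'rV[R]_(p + q)) :
  basis_of E e -> orthonormal s e -> basis_of F h -> orthonormal s h ->
  orthonormal s w -> (E + F)%VS = fullv ->
  (forall u v, u \in E -> v \in F ->
     ipnorm s u <= K * ipnorm s (u + v) /\ ipnorm s v <= K * ipnorm s (u + v)) ->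
  let A := gram_mx s (col_mx (frame e) (frame h)) (frame w) in
  `|\det A| <= (p + q)`!%:R /\
  1 <= (p + q)`!%:R * K ^+ (p + q) * `|\det A|.
Proof.
move=> eE se hF sh sw EF EFK; set P := col_mx _ _; set A := gram_mx _ _ _ => /=.
have PA : P = A *m frame w by apply: (frame_expand _ sw).
split.
  rewrite -[leRHS]mulr1 -[X in _ <= _ * X](expr1n _ (p + q)).
  apply: det_le_fact => i j.
  rewrite mxE rowK (le_trans (orthonormal_coef_le _ _ sw)) // /P.
  case: (split_ordP i) => k ->; rewrite ?rowKu ?rowKd rowK.
    by rewrite orthonormal_norm.
  by rewrite orthonormal_norm.
have /boolp.choice[u /boolp.choice[v uvP]] : forall j : 'I_(p + q), exists u v,
    [/\ u \in E, v \in F & tnth w j = u + v].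
  move=> j; have : tnth w j \in (E + F)%VS by rewrite EF memvf.
  by move=> /memv_addP[u uE [v vF uv]]; exists u, v.
pose B : 'M[R]_(p + q) := row_mx (gram_mx s (\matrix_j u j) (frame e))
                                 (gram_mx s (\matrix_j v j) (frame h)).
have WB : frame w = B *m P.
  rewrite mul_row_col; apply/row_matrixP => j; rewrite linearD /= !row_mul.
  have [uE vF uv] := uvP j.
  rewrite rowK uv !mulmx_sum_row; congr (_ + _).
    rewrite {1}(orthonormal_expand eE se uE).
    by apply: eq_bigr => i _; rewrite !mxE !rowK.
  rewrite {1}(orthonormal_expand hF sh vF).
  by apply: eq_bigr => i _; rewrite !mxE !rowK.
have BA : B *m A = 1%:M.
  by rewrite -(gram_mx_orthonormal sw) {1}WB gram_mx_mulVr.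
have Ble : `|\det B| <= (p + q)`!%:R * K ^+ (p + q).
  apply: det_le_fact => j i; have [uE vF uv] := uvP j.
  have [uK vK] := EFK _ _ uE vF.
  rewrite -uv !(orthonormal_norm _ sw) mulr1 in uK vK.
  case: (split_ordP i) => k ->; rewrite ?row_mxEl ?row_mxEr mxE !rowK.
    by rewrite (le_trans (orthonormal_coef_le _ _ se)).
  by rewrite (le_trans (orthonormal_coef_le _ _ sh)).
have BA1 : `|\det B| * `|\det A| = 1.
  by rewrite -normrM -det_mulmx BA det1 normr1.
rewrite -[leLHS]BA1.
by rewrite ler_wpM2r.
Qed.

Lemma splitting_map_block s E F E' F'
    (T : {linear 'rV[R]_(p + q) -> 'rV[R]_(p + q)})
    (e e' : p.-tuple 'rV[R]_(p + q)) (h h' : q.-tuple 'rV[R]_(p + q)) :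
  basis_of E e -> basis_of E' e' -> orthonormal s e' ->
  basis_of F h -> basis_of F' h' -> orthonormal s h' ->
  (forall u, u \in E -> T u \in E') -> (forall v, v \in F -> T v \in F') ->
  (\matrix_k T (row k (col_mx (frame e) (frame h)))) =
  block_mx (\matrix_(i, j) s (T (tnth e i)) (tnth e' j)) 0
           0 (\matrix_(i, j) s (T (tnth h i)) (tnth h' j))
  *m col_mx (frame e') (frame h').
Proof.
move=> eE eE' se' hF hF' sh' TE TF.
rewrite mul_block_col !mul0mx addr0 add0r; apply/row_matrixP => i.
rewrite rowK; case: (split_ordP i) => k ->; rewrite ?rowKu ?rowKd rowK row_mul
  mulmx_sum_row.
  have TeE : T (tnth e k) \in E' by apply/TE/(basis_mem eE)/mem_tnth.
  rewrite {1}(orthonormal_expand eE' se' TeE).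
  by apply: eq_bigr => j _; rewrite !mxE rowK.
have ThF : T (tnth h k) \in F' by apply/TF/(basis_mem hF)/mem_tnth.
rewrite {1}(orthonormal_expand hF' sh' ThF).
by apply: eq_bigr => j _; rewrite !mxE rowK.
Qed.

End Splitting.

(** X and Y stand for the volume factors along E and F. Splitting X^(p+q) into
    X^q and X^p lets the factor (b^q Y)^p, which is at least a constant, turn
    X^p into a power of X Y; only the product a b then remains. *)
Lemma domination_volume_bound (R : realType) (p q : nat) (X Y a b P Q L : R) :
  0 <= X -> 0 <= Y -> 0 <= a -> 0 <= b -> 0 <= P -> 0 <= Q ->
  X <= P * a ^+ p -> 1 <= Q * b ^+ q * Y -> X * Y <= L ->
  X ^+ (p + q) <= P ^+ q * Q ^+ p * L ^+ p * (a * b) ^+ (p * q).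
Proof.
move=> X0 Y0 a0 b0 P0 Q0 XP YQ XYL.
have Xq : X ^+ q <= P ^+ q * a ^+ (p * q).
  by rewrite exprM -exprMn lerXn2r ?nnegrE // mulr_ge0 ?exprn_ge0.
have Xp : X ^+ p <= Q ^+ p * b ^+ (p * q) * L ^+ p.
  rewrite mulnC exprM -!exprMn lerXn2r ?nnegrE //.
    by rewrite !mulr_ge0 ?exprn_ge0 // (le_trans _ XYL) ?mulr_ge0.
  rewrite -[X]mulr1 (le_trans (ler_wpM2l X0 YQ)) //.
  by rewrite mulrCA ler_wpM2l // mulr_ge0 ?exprn_ge0.
rewrite exprD (le_trans (ler_pM _ _ Xp Xq)) ?exprn_ge0 // exprMn.
by rewrite le_eqVlt; apply/orP; left; apply/eqP; ring.
Qed.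

(** By domination, T u is at most half as long as T v if |u| <= |v|. If u + v is
    short, then so is T (u + v); hence so is T v, because T u can cancel at most
    about half of it; hence so are v and u. *)
Lemma transverse_of_domination (R : realType) (d : nat)
    (s s' : inner_product R d) (T : {linear 'rV[R]_d -> 'rV[R]_d})
    (K a b : R) (u v : 'rV[R]_d) :
  (forall z, ipnorm s' (T z) <= K * ipnorm s z) ->
  (forall z, ipnorm s z <= K * ipnorm s' (T z)) ->
  0 <= K -> 0 <= b -> a * b <= 1 / 2 ->
  ipnorm s' (T u) <= a * ipnorm s u -> ipnorm s v <= b * ipnorm s' (T v) ->
  ipnorm s u <= (1 + 4 * K ^+ 2) * ipnorm s (u + v) /\
  ipnorm s v <= (1 + 4 * K ^+ 2) * ipnorm s (u + v).
Proof.
move=> TK KT K0 b0 ab Tu Tv.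
(* a is replaced by min a K, so that a |u + v| is controlled by K. *)
wlog aK : a ab Tu / a <= K.
  move=> H; have [/H|/ltW Ka] := leP a K; first exact.
  apply: (H K) => //; first by rewrite (le_trans (ler_wpM2r b0 Ka)).
have uw : ipnorm s u <= ipnorm s (u + v) + ipnorm s v.
  by rewrite -[u in leLHS](addrK v) (le_trans (ipnorm_triangle _ _ _)) //
    -scaleN1r ipnormZ normrN1 mul1r.
have [a0|a0] := ltP a 0.
  have u0 : ipnorm s u = 0.
    apply/eqP; rewrite eq_le ipnorm_ge0 andbT.
    have := le_trans (ipnorm_ge0 _ _) Tu.
    by rewrite nmulr_rge0.
  have {}u0 : u = 0.
    by apply/eqP; apply: contraPT u0 => /(ipnorm_gt0 s) /gt_eqF/eqP.
  rewrite u0 add0r ipnorm0; have := ipnorm_ge0 s v; have := sqr_ge0 K.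
  by split; nra.
have TvTw : ipnorm s' (T v) <= ipnorm s' (T (u + v)) + ipnorm s' (T u).
  rewrite linearD; have -> : ipnorm s' (T u) = ipnorm s' (- T u).
    by rewrite -scaleN1r ipnormZ normrN1 mul1r.
  by rewrite -[T v in leLHS](addKr (T u)) addrC ipnorm_triangle.
have Tw := TK (u + v).
set W := ipnorm s (u + v) in uw Tw *.
have W0 : 0 <= W by exact: ipnorm_ge0.
have Tu' : ipnorm s' (T u) <= K * W + 1 / 2 * ipnorm s' (T v).
  rewrite (le_trans Tu) // (le_trans (ler_wpM2l a0 uw)) // mulrDr lerD //.
    by rewrite ler_wpM2r.
  rewrite (le_trans (ler_wpM2l a0 Tv)) // mulrA ler_wpM2r ?ipnorm_ge0 //.
have Tv4 : ipnorm s' (T v) <= 4 * (K * W) by lra.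
have v4 : ipnorm s v <= 4 * K ^+ 2 * W.
  rewrite (le_trans (KT v)) // (le_trans (ler_wpM2l K0 Tv4)) //.
  by rewrite le_eqVlt; apply/orP; left; apply/eqP; ring.
by split; lra.
Qed.

(** * Derivatives read in charts *)

Lemma near_eq_diff (R : realType) (V W : normedModType R) (f g : V -> W) (x : V) :
  {near x, f =1 g} -> differentiable f x ->
  differentiable g x /\ 'd g x = 'd f x :> (V -> W).
Proof.
move=> fg /diff_locallyP[dfc dfE].
have fgx : f x = g x by apply: (nbhs_singleton fg).
have gE : g \o shift x = cst (g x) + 'd f x +o_ 0 id.
  apply/eqaddoP => e e0; move/eqaddoP: dfE => /(_ e e0) fe.
  have fg0 : \forall y \near (0 : V), f (y + x) = g (y + x).
    have fgx' : \forall y \near x, f y = g y := fg.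
    by move: fgx'; rewrite (near_shift 0 x) subr0.
  apply: filterS2 fg0 fe => y /=.
  by rewrite /shift /= !fctE /cst /= fgx => ->.
have dg : 'd g x = 'd f x :> (V -> W) by exact: diff_unique.
split; last exact: dg.
by apply/diff_locallyP; rewrite dg; split; [exact: dfc|exact: gE].
Qed.

Section ChartCalculus.
Context {R : realType} {d : nat} {M : smooth_manifold R d}.
Implicit Types (i j k : chart_index M) (x : M) (h : M -> M).

Definition in_charts i j h : 'rV[R]_d -> 'rV[R]_d :=
  chart j \o h \o chart_inv i.

Lemma near_chart i x (P : set M) : chart_dom i x ->
  (\forall z \near x, P z) -> \forall y \near chart i x, P (chart_inv i y).
Proof.
move=> ix Px; have : {for chart i x, continuous (chart_inv i)}.
  by apply: chart_inv_continuous; exists x.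
by apply; rewrite chartK.
Qed.

Lemma near_chart_dom i x : chart_dom i x -> \forall z \near x, chart_dom i z.
Proof. by move=> ix; apply: open_nbhs_nbhs; split => //; exact: chart_dom_open. Qed.

Lemma near_chart_invK i x : chart_dom i x ->
  \forall y \near chart i x, chart i (chart_inv i y) = y.
Proof.
move=> ix; have : \forall y \near chart i x, (chart i @` chart_dom i) y.
  by apply: open_nbhs_nbhs; split; [exact: chart_image_open|exists x].
by apply: filterS => y [z iz <-]; rewrite chartK.
Qed.

(** Differentiability is asked in all pairs of charts around x and h x, so that
    compositions may pass through any intermediate chart. *)
Definition differentiable_at_point h x : Prop :=
  {for x, continuous h} /\ forall i j, chart_dom i x -> chart_dom j (h x) ->
    differentiable (in_charts i j h) (chart i x).

(** The intermediate chart only cancels where its domain is met, hence an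
    equality of germs and not of functions. *)
Lemma in_charts_comp i j k h1 h2 x : {for x, continuous h1} ->
  chart_dom i x -> chart_dom j (h1 x) ->
  {near chart i x, in_charts j k h2 \o in_charts i j h1 =1
                   in_charts i k (h2 \o h1)}.
Proof.
move=> h1c ix jx.
have := near_chart ix (h1c _ (near_chart_dom jx)).
by apply: filterS => y jy; rewrite /in_charts /= chartK.
Qed.

Lemma differentiable_in_charts_comp i j k h1 h2 x :
  differentiable_at_point h1 x -> differentiable_at_point h2 (h1 x) ->
  chart_dom i x -> chart_dom j (h1 x) -> chart_dom k (h2 (h1 x)) ->
  differentiable (in_charts i k (h2 \o h1)) (chart i x) /\
  forall u, 'd (in_charts i k (h2 \o h1)) (chart i x) u =
    'd (in_charts j k h2) (chart j (h1 x)) ('d (in_charts i j h1) (chart i x) u).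
Proof.
move=> [h1c dh1] [_ dh2] ix jx kx.
have d1 := dh1 _ _ ix jx.
have h1E : in_charts i j h1 (chart i x) = chart j (h1 x).
  by rewrite /in_charts /= chartK.
have d2 : differentiable (in_charts j k h2) (in_charts i j h1 (chart i x)).
  by rewrite h1E; exact: dh2.
have dc := differentiable_comp d1 d2.
have nE := in_charts_comp k h2 h1c ix jx.
have [dcomp dE] := near_eq_diff nE dc.
split; first exact: dcomp.
move=> u; apply: (etrans (congr1 (fun F => F u) dE)).
by apply: (etrans (congr1 (fun F => F u) (diff_comp d1 d2))); rewrite /= h1E.
Qed.

Lemma differentiable_at_point_comp h1 h2 x :
  differentiable_at_point h1 x -> differentiable_at_point h2 (h1 x) ->
  differentiable_at_point (h2 \o h1) x.
Proof.
move=> dh1 dh2; split; first by apply: continuous_comp; [case: dh1|case: dh2].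
move=> i k ix kx.
by have [] := differentiable_in_charts_comp dh1 dh2 ix (chart_at_dom (h1 x)) kx.
Qed.

Lemma differentiable_at_point_id x : differentiable_at_point id x.
Proof.
split; first exact: cvg_id.
move=> i j ix jx; have [+ _] := @chart_smooth _ _ M i j 1%N.
by apply; exists x.
Qed.

Lemma diff_in_charts_id i x : chart_dom i x ->
  'd (in_charts i i id) (chart i x) = id :> ('rV[R]_d -> 'rV[R]_d).
Proof.
move=> ix; have iE : {near chart i x, id =1 in_charts i i id}.
  by apply: filterS (near_chart_invK ix) => y; rewrite /in_charts /=.
have [|_ ->] := near_eq_diff iE; first exact: ex_diff.
exact: diff_val.
Qed.

Lemma differentiable_at_point_C1 h x : C1_map h -> differentiable_at_point h x.
Proof.
by move=> [hc dh]; split=> [|i j ix jx]; [exact: hc|apply: (dh i j).1; exists x].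
Qed.

Lemma differentiable_at_point_iter h n x :
  (forall y, differentiable_at_point h y) -> differentiable_at_point (iter n h) x.
Proof.
move=> dh; elim: n => [|n IH]; first exact: differentiable_at_point_id.
exact: (@differentiable_at_point_comp (iter n h) h).
Qed.

Lemma tangent_map_comp h1 h2 x u :
  differentiable_at_point h1 x -> differentiable_at_point h2 (h1 x) ->
  tangent_map (h2 \o h1) x u = tangent_map h2 (h1 x) (tangent_map h1 x u).
Proof.
move=> dh1 dh2.
by have [_] := differentiable_in_charts_comp dh1 dh2 (chart_at_dom x)
  (chart_at_dom (h1 x)) (chart_at_dom (h2 (h1 x))).
Qed.

Lemma tangent_map_id x u : tangent_map (id : M -> M) x u = u.
Proof.
have idu := congr1 (fun F => F u) (diff_in_charts_id (chart_at_dom x)).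
exact: idu.
Qed.

(** Coordinate fields of arbitrary charts are mapped by the Jacobian matrix in
    these charts. The identification of the tangent spaces by [chart_at] may
    jump from point to point; this formula is what allows continuity arguments. *)
Lemma tangent_map_coord_vector h x i j u : differentiable_at_point h x ->
  chart_dom i x -> chart_dom j (h x) ->
  tangent_map h x (coord_vector i x u) =
  coord_vector j (h x) ('d (in_charts i j h) (chart i x) u).
Proof.
move=> dh ix jx.
have [_ hid] := differentiable_in_charts_comp
  (differentiable_at_point_id x) dh ix (chart_at_dom x) (chart_at_dom (h x)).
have [_ idh] := differentiable_in_charts_comp
  dh (differentiable_at_point_id (h x)) ix jx (chart_at_dom (h x)).
exact: etrans (esym (hid u)) (idh u).
Qed.

Lemma coord_vector_inj i x : chart_dom i x -> injective (coord_vector i x).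
Proof.
move=> ix; have dx := differentiable_at_point_id x.
have [_ idE] := differentiable_in_charts_comp dx dx ix (chart_at_dom x) ix.
apply: (can_inj (g := 'd (in_charts (chart_at x) i id) (chart (chart_at x) x))).
move=> u; apply: etrans (esym (idE u)) _.
have idu := congr1 (fun F => F u) (diff_in_charts_id ix).
exact: idu.
Qed.

End ChartCalculus.

(** * Continuity of determinants and compactness *)

Section MatrixContinuity.
Context {R : realType} {T : topologicalType} (y : T).

Definition mx_continuous m n (A : T -> 'M[R]_(m, n)) : Prop :=
  forall i j, A z i j @[z --> y] --> A y i j.

Lemma cvg_sum_at (I : Type) (r : seq I) (P : pred I) (f : I -> T -> R) :
  (forall i, P i -> f i z @[z --> y] --> f i y) ->
  \sum_(i <- r | P i) f i z @[z --> y] --> \sum_(i <- r | P i) f i y.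
Proof. by apply: cvg_big; exact: add_continuous. Qed.

Lemma cvg_prod_at (I : Type) (r : seq I) (P : pred I) (f : I -> T -> R) :
  (forall i, P i -> f i z @[z --> y] --> f i y) ->
  \prod_(i <- r | P i) f i z @[z --> y] --> \prod_(i <- r | P i) f i y.
Proof. by apply: cvg_big; exact: mul_continuous. Qed.

Lemma cvg_inv_at (f : T -> R) : f y != 0 ->
  f z @[z --> y] --> f y -> (f z)^-1 @[z --> y] --> (f y)^-1.
Proof. by move=> f0 fc; exact: (cvgV f0 fc). Qed.

Lemma mx_continuous_mul m n k (A : T -> 'M[R]_(m, n)) (B : T -> 'M[R]_(n, k)) :
  mx_continuous A -> mx_continuous B -> mx_continuous (fun z => A z *m B z).
Proof.
move=> cA cB i j; rewrite mxE; under eq_cvg do rewrite mxE.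
by apply: cvg_sum_at => l _; apply: cvgM; [exact: cA|exact: cB].
Qed.

Lemma mx_continuous_tr m n (A : T -> 'M[R]_(m, n)) :
  mx_continuous A -> mx_continuous (fun z => (A z)^T).
Proof. by move=> cA i j; rewrite mxE; under eq_cvg do rewrite mxE; exact: cA. Qed.

Lemma continuous_det n (A : T -> 'M[R]_n) :
  mx_continuous A -> \det (A z) @[z --> y] --> \det (A y).
Proof.
move=> cA; rewrite /determinant; apply: cvg_sum_at => s _.
by apply: cvgM; [exact: cvg_cst|apply: cvg_prod_at => i _; exact: cA].
Qed.

Lemma mx_continuous_adj n (A : T -> 'M[R]_n) :
  mx_continuous A -> mx_continuous (fun z => \adj (A z)).
Proof.
move=> cA i j; rewrite mxE; under eq_cvg do rewrite mxE.
rewrite /cofactor; apply: cvgM; first exact: cvg_cst.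
apply: (@continuous_det _ (fun z => row' j (col' i (A z)))) => k l.
by rewrite !mxE; under eq_cvg do rewrite !mxE; exact: cA.
Qed.

Lemma continuous_trace n (A : T -> 'M[R]_n) :
  mx_continuous A -> \tr (A z) @[z --> y] --> \tr (A y).
Proof. by move=> cA; apply: cvg_sum_at => i _; exact: cA. Qed.

End MatrixContinuity.

Lemma compact_locally_bounded (R : realType) (T : topologicalType) (H : T -> R) :
  compact [set: T] ->
  (forall x : T, exists C, \forall z \near x, H z <= C) ->
  exists C, forall x, H x <= C.
Proof.
move=> /compact_near_coveringP cT HC.
have : \forall C \near +oo, [set: T] `<=` [set x | H x <= C].
  apply: (cT _ _ (fun C x => H x <= C)) => x _; have [C xC] := HC x.
  exists ([set z | H z <= C], [set K | C <= K]) => /=.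
    by split=> //; apply: nbhs_pinfty_ge; rewrite num_real.
  by move=> [z K] /= [zC CK]; exact: le_trans CK.
by move=> /filter_ex[C HCC]; exists C => x; exact: HCC.
Qed.

(** A function need only agree near each point with a continuous function of the
    coordinates in some chart, which may depend on the point. *)
Lemma bounded_in_charts (R : realType) (d : nat) (M : smooth_manifold R d)
    (H : M -> R) : compact [set: M] ->
  (forall x0 : M, exists i (r : 'rV[R]_d -> R), [/\ chart_dom i x0,
     r y @[y --> chart i x0] --> r (chart i x0) &
     \forall x \near x0, H x = r (chart i x)]) ->
  exists C, forall x, H x <= C.
Proof.
move=> cM HP; apply: compact_locally_bounded => // x0.
have [i [r [ix rc Hr]]] := HP x0; exists (r (chart i x0) + 1).
have rb : \forall y \near chart i x0, r y <= r (chart i x0) + 1.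
  have /cvgrPdist_le /(_ 1 ltr01) := rc; apply: filterS => y.
  by rewrite ler_norml => /andP[+ _]; lra.
have cb : \forall x \near x0, r (chart i x) <= r (chart i x0) + 1.
  exact: (chart_continuous ix rb).
by apply: filterS2 Hr cb => x ->.
Qed.

Definition metric_ip (R : realType) (d : nat) (M : smooth_manifold R d)
    (g : riemannian_metric M) (x : M) : inner_product R d :=
  InnerProduct (metric_sym g x) (metric_linear g x) (@metric_pos _ _ _ g x).

(** * Coordinate frames and uniform bounds *)

Section ChartFrames.
Context {R : realType} {d : nat} {M : smooth_manifold R d}
  (g : riemannian_metric M).
Implicit Types (i j : chart_index M) (x : M).

Definition coord_frame i x : 'M[R]_d := \matrix_k coord_vector i x (row k 1%:M).

Lemma mul_coord_frame m i x (A : 'M[R]_(m, d)) :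
  A *m coord_frame i x = \matrix_k coord_vector i x (row k A).
Proof.
apply/row_matrixP => k; rewrite rowK row_mul mulmx_sum_row /coord_vector.
rewrite -[row k A in RHS]mulmx1 [in RHS]mulmx_sum_row linear_sum.
by apply: eq_bigr => l _; rewrite linearZ rowK.
Qed.

Lemma coord_frame_unit i x : chart_dom i x -> coord_frame i x \in unitmx.
Proof.
move=> ix; rewrite -row_free_unit; apply: inj_row_free => v.
rewrite mul_coord_frame => /(congr1 (row 0)); rewrite rowK row0 row_id => v0.
by apply: (coord_vector_inj ix); rewrite v0 /coord_vector linear0.
Qed.

Definition coord_gram i (y : 'rV[R]_d) : 'M[R]_d :=
  let x := chart_inv i y in
  gram_mx (metric_ip g x) (coord_frame i x) (coord_frame i x).

Lemma coord_gram_chart i x : chart_dom i x -> coord_gram i (chart i x) =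
  gram_mx (metric_ip g x) (coord_frame i x) (coord_frame i x).
Proof. by move=> ix; rewrite /coord_gram chartK. Qed.

Lemma coord_gram_continuous i x : chart_dom i x ->
  mx_continuous (chart i x) (coord_gram i).
Proof.
move=> ix k l.
have := metric_smooth g i (row k 1%:M) (row l 1%:M) 0%N.
move=> /(_ (chart i x)) /(_ (ex_intro2 _ _ x ix erefl)).
rewrite /= /coord_gram /gram_mx.
have E : (fun z => (\matrix_(i0, j) metric_ip g (chart_inv i z)
  (row i0 (coord_frame i (chart_inv i z)))
  (row j (coord_frame i (chart_inv i z)))) k l) = (fun y =>
  g (chart_inv i y) (coord_vector i (chart_inv i y) (row k 1%:M))
      (coord_vector i (chart_inv i y) (row l 1%:M))).
  by apply/funext => z; rewrite mxE !rowK.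
by rewrite -E.
Qed.

(** The transition matrix A from an orthonormal frame to a coordinate frame is a
    square root of the Gram matrix in coordinates; unlike A, the Gram matrix
    depends continuously on the point. *)
Lemma coord_gram_frame i x (w : d.-tuple 'rV[R]_d) : chart_dom i x ->
  orthonormal (metric_ip g x) w ->
  exists A : 'M[R]_d, [/\ A \in unitmx, coord_frame i x = A *m frame w &
    coord_gram i (chart i x) = A *m A^T].
Proof.
move=> ix gw; exists (gram_mx (metric_ip g x) (coord_frame i x) (frame w)).
have JA := frame_expand (coord_frame i x) gw.
split=> //.
  by have := coord_frame_unit ix; rewrite {1}JA unitmx_mul => /andP[].
by rewrite coord_gram_chart // {1 2}JA gram_mx_mul gram_mx_orthonormal // mulmx1.
Qed.

Lemma det_coord_gram_neq0 i x : chart_dom i x ->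
  \det (coord_gram i (chart i x)) != 0.
Proof.
move=> ix; have [w gw] := orthonormal_frame_exists (metric_ip g x).
have [A [uA _ ->]] := coord_gram_frame ix gw.
by rewrite det_mulmx det_tr mulf_neq0 // -unitfE -unitmxE.
Qed.

End ChartFrames.
Section CompactBounds.
Context {R : realType} {d : nat} {M : smooth_manifold R d}
  (g : riemannian_metric M).

Section Density.
Variable omega : volume_form M.

Lemma volume_form_mulmx x (A B : 'M[R]_d) :
  omega x (A *m B) = \det A * omega x B.
Proof.
by apply: alternating_form_mulmx;
  [exact: vol_multilinear|exact: vol_alternate].
Qed.

Let coord_vol i (y : 'rV[R]_d) : R :=
  omega (chart_inv i y) (coord_frame i (chart_inv i y)).

Let coord_vol_continuous i x : chart_dom i x ->
  coord_vol i y @[y --> chart i x] --> coord_vol i (chart i x).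
Proof.
move=> ix; have := @vol_smooth _ _ _ omega i 1%:M 0%N.
by move=> /(_ (chart i x)); apply; exists x.
Qed.

(** The square of the density does not depend on the orthonormal frame, and is
    expressed by quantities that are continuous in coordinates. *)
Let density_chart i x (w : d.-tuple 'rV[R]_d) : chart_dom i x ->
  orthonormal (metric_ip g x) w ->
  omega x (frame w) ^+ 2 =
  coord_vol i (chart i x) ^+ 2 / \det (coord_gram g i (chart i x)).
Proof.
move=> ix gw; have [A [uA JA ->]] := coord_gram_frame ix gw.
rewrite /coord_vol chartK // JA volume_form_mulmx det_mulmx det_tr exprMn -expr2.
by rewrite mulrAC divff ?mul1r // sqrf_eq0 -unitfE -unitmxE.
Qed.

Let density_neq0 x (w : d.-tuple 'rV[R]_d) :
  orthonormal (metric_ip g x) w -> omega x (frame w) != 0.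
Proof.
move=> gw; have [A] := vol_neq0 omega x.
rewrite (frame_expand A gw) volume_form_mulmx.
by apply: contraNneq => ->; rewrite mulr0.
Qed.

(** The density is bounded above, and away from zero because it never vanishes. *)
Lemma compact_density_bounds : compact [set: M] ->
  exists2 L : R, 0 < L & forall x (w : d.-tuple 'rV[R]_d),
    orthonormal (metric_ip g x) w ->
    `|omega x (frame w)| <= L /\ 1 <= L * `|omega x (frame w)|.
Proof.
move=> cM.
have /boolp.choice[w gw] : forall x, exists w : d.-tuple 'rV[R]_d,
  orthonormal (metric_ip g x) w by move=> x; exact: orthonormal_frame_exists.
pose rho i y := coord_vol i y ^+ 2 / \det (coord_gram g i y).
have rhoc i x : chart_dom i x -> rho i y @[y --> chart i x] --> rho i (chart i x).
  move=> ix; have volc := coord_vol_continuous ix.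
  have detc := continuous_det (coord_gram_continuous (g := g) ix).
  have detVc := cvg_inv_at
    (f := fun y => \det (coord_gram g i y)) (det_coord_gram_neq0 g ix) detc.
  exact: (cvgM (cvgM volc volc) detVc).
have rhoE i x w' : chart_dom i x -> orthonormal (metric_ip g x) w' ->
    omega x (frame w') ^+ 2 = rho i (chart i x).
  by move=> ix gw'; exact: density_chart.
have [C CP] : exists C, forall x, omega x (frame (w x)) ^+ 2 <= C.
  apply: bounded_in_charts => // x0; exists (chart_at x0), (rho (chart_at x0)).
  split; [exact: chart_at_dom|exact/rhoc/chart_at_dom|].
  by apply: filterS (near_chart_dom (chart_at_dom x0)) => x ix; exact: rhoE.
have [D DP] : exists D, forall x, (omega x (frame (w x)) ^+ 2)^-1 <= D.
  apply: bounded_in_charts => // x0.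
  exists (chart_at x0), (fun y => (rho (chart_at x0) y)^-1).
  split; [exact: chart_at_dom| |].
    apply: (@cvg_inv_at _ _ _ (rho (chart_at x0))); last exact/rhoc/chart_at_dom.
    by rewrite -(rhoE _ _ _ (chart_at_dom x0) (gw x0)) sqrf_eq0 density_neq0.
  apply: filterS (near_chart_dom (chart_at_dom x0)) => x ix.
  by congr (_^-1); exact: rhoE.
exists (1 + `|C| + `|D|) => [|x w' gw'].
  by rewrite -addrA ltr_pwDl // addr_ge0.
have ww : omega x (frame w') ^+ 2 = omega x (frame (w x)) ^+ 2.
  by rewrite !(rhoE (chart_at x)) // ; exact: chart_at_dom.
have := CP x; have := DP x.
rewrite -ww -[_ ^+ 2]real_normK ?num_real // => {}DP {}CP.
set t := `|omega x (frame w')| in CP DP *.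
have t0 : 0 < t by rewrite normr_gt0 density_neq0.
have CC := ler_norm C; have DD := ler_norm D.
have C0 := normr_ge0 C; have D0 := normr_ge0 D.
have := sqr_ge0 (t - 1) => tt.
split; first by nra.
have D1 : 1 <= D * t ^+ 2.
  by rewrite -ler_pdivrMr ?exprn_gt0 // div1r.
have [t1|t1] := leP 1 t; first by nra.
have : D * t ^+ 2 <= `|D| * t by rewrite expr2 mulrA; nra.
by nra.
Qed.

End Density.

(** The sum S of the squared lengths of the images of an orthonormal basis
    bounds the derivative. It is the trace of G^-1 J G' J^T, where G and G' are
    the Gram matrices of charts at the source and at the target and J is the
    Jacobian matrix, so it is continuous in coordinates. *)
Lemma compact_tangent_bound (h : M -> M) : compact [set: M] -> C1_map h ->
  exists2 K : R, 0 <= K & forall x u,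
    ipnorm (metric_ip g (h x)) (tangent_map h x u) <=
    K * ipnorm (metric_ip g x) u.
Proof.
move=> cM C1h; have dh x := differentiable_at_point_C1 x C1h.
have /boolp.choice[w gw] : forall x, exists w : d.-tuple 'rV[R]_d,
  orthonormal (metric_ip g x) w by move=> x; exact: orthonormal_frame_exists.
pose jac i j (y : 'rV[R]_d) : 'M[R]_d :=
  \matrix_k 'D_(row k 1%:M) (in_charts i j h) y.
(* The inverse of G is written as the adjugate divided by the determinant. *)
pose sigma i j y := \tr (\adj (coord_gram g i y) *m
  (jac i j y *m coord_gram g j (in_charts i j h y) *m (jac i j y)^T)) /
  \det (coord_gram g i y).
pose S x := \sum_k ipnorm (metric_ip g (h x)) (tangent_map h x (tnth (w x) k)) ^+ 2.
have jacE i j x : chart_dom i x -> chart_dom j (h x) ->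
    \matrix_k tangent_map h x (row k (coord_frame i x)) =
    jac i j (chart i x) *m coord_frame j (h x).
  move=> ix jx; rewrite mul_coord_frame; apply/row_matrixP => k.
  rewrite !rowK (tangent_map_coord_vector _ (dh x) ix jx) deriveE //.
  exact: (dh x).2.
have SE i j x : chart_dom i x -> chart_dom j (h x) -> S x = sigma i j (chart i x).
  move=> ix jx; rewrite /sigma.
  have hxE : in_charts i j h (chart i x) = chart j (h x).
    by rewrite /in_charts /= chartK.
  have [A [uA JA ->]] := coord_gram_frame ix (gw x).
  rewrite hxE coord_gram_chart //.
  set B := jac i j (chart i x); set J' := coord_frame j (h x).
  set s' := metric_ip g (h x).
  pose TW : 'M[R]_d := \matrix_k tangent_map h x (tnth (w x) k).
  have ATW : A *m TW = B *m J'.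
    rewrite -jacE // JA; apply/row_matrixP => k; rewrite rowK !row_mul.
    rewrite !mulmx_sum_row linear_sum; apply: eq_bigr => l _.
    by rewrite linearZ !rowK.
  have -> : S x = \tr (gram_mx s' TW TW).
    by apply: eq_bigr => k _; rewrite mxE rowK ipnormE.
  rewrite -gram_mx_mul -ATW gram_mx_mul.
  set G := gram_mx s' TW TW.
  have -> : \adj (A *m A^T) *m (A *m G *m A^T) =
      \adj (A *m A^T) *m A *m G *m A^T by rewrite !mulmxA.
  rewrite mxtrace_mulC !mulmxA.
  have -> : A^T *m \adj (A *m A^T) *m A = (\det (A *m A^T))%:M.
    apply: (can_inj (mulKmx uA)); rewrite !mulmxA mul_mx_adj.
    by rewrite mul_scalar_mx mul_mx_scalar.
  rewrite mul_scalar_mx mxtraceZ mulrAC divff ?mul1r //.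
  by rewrite det_mulmx det_tr mulf_neq0 // -unitfE -unitmxE.
have sigmac i j x : chart_dom i x -> chart_dom j (h x) ->
    sigma i j y @[y --> chart i x] --> sigma i j (chart i x).
  move=> ix jx.
  have hxE : in_charts i j h (chart i x) = chart j (h x).
    by rewrite /in_charts /= chartK.
  have hc : in_charts i j h y @[y --> chart i x] --> in_charts i j h (chart i x).
    exact/differentiable_continuous/(dh x).2.
  have jacc : mx_continuous (chart i x) (jac i j).
    move=> k l; pose v : 'rV[R]_d := row k 1%:M.
    have jacvE : (fun y => jac i j y k l) = fun y => 'D_v (in_charts i j h) y 0 l.
      by apply/funext => y; rewrite /jac mxE.
    have [_ /(_ i j)[_ /(_ v) /(_ (chart i x)) Dc]] := C1h.
    have Dcx : 'D_v (in_charts i j h) y @[y --> chart i x] -->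
      'D_v (in_charts i j h) (chart i x) by apply: Dc; exists x.
    rewrite jacvE [jac _ _ _ _ _]mxE -/v.
    exact: (@cvg_comp _ _ _ _ (fun A : 'rV[R]_d => A 0 l) _ _ _ Dcx
      (@coord_continuous _ _ _ _ _ _)).
  have detc := continuous_det (coord_gram_continuous (g := g) ix).
  have detVc := cvg_inv_at
    (f := fun y => \det (coord_gram g i y)) (det_coord_gram_neq0 g ix) detc.
  apply: (cvgM _ detVc).
  apply: continuous_trace; apply: mx_continuous_mul.
    by apply: mx_continuous_adj; exact: coord_gram_continuous.
  apply: mx_continuous_mul; last exact: mx_continuous_tr.
  apply: mx_continuous_mul => // k l.
  have gc : coord_gram g j z k l @[z --> in_charts i j h (chart i x)] -->
      coord_gram g j (in_charts i j h (chart i x)) k l.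
    by rewrite hxE; exact: coord_gram_continuous.
  exact: (@cvg_comp _ _ _ (in_charts i j h)
    (fun z => coord_gram g j z k l) _ _ _ hc gc).
have [C CP] : exists C, forall x, S x <= C.
  apply: bounded_in_charts => // x0.
  pose i := chart_at x0; pose j := chart_at (h x0).
  exists i, (sigma i j); split; [exact: chart_at_dom| |].
    by apply: sigmac; exact: chart_at_dom.
  have ix0 := near_chart_dom (chart_at_dom x0).
  have jx0 : \forall x \near x0, chart_dom j (h x).
    by apply: (dh x0).1; exact/near_chart_dom/chart_at_dom.
  by apply: filterS2 ix0 jx0 => x ix jx; exact: SE.
exists (d%:R + `|C|) => [|x u]; first by rewrite addr_ge0.
rewrite (le_trans (ipnorm_linear_le _ _ _ (gw x))) // ler_wpM2r ?ipnorm_ge0 //.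
have -> : d%:R = \sum_(k < d) 1 :> R by rewrite sumr_const card_ord.
apply: (@le_trans _ _ (\sum_(k < d) 1 + S x)); last first.
  by rewrite lerD2l (le_trans (CP x)) ?ler_norm.
rewrite -big_split; apply: ler_sum => k _ /=.
(* The lengths are compared to their squares by t <= 1 + t ^+ 2. *)
set t := ipnorm _ _; have := sqr_ge0 (t - 1); have := sqr_ge0 t; nra.
Qed.

End CompactBounds.

(** * Norms and determinants of restricted derivatives *)

Section RestrictedDerivative.
Context {R : realType} {d : nat} {M : smooth_manifold R d}
  (g : riemannian_metric M).
Implicit Types (h : M -> M) (x : M) (E : {vspace 'rV[R]_d}).

Lemma restr_absdet_basis h x E E' k (e e' : k.-tuple 'rV[R]_d) :
  basis_of E e -> basis_of E' e' ->
  orthonormal (metric_ip g x) e -> orthonormal (metric_ip g (h x)) e' ->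
  (forall u, u \in E -> tangent_map h x u \in E') ->
  restr_absdet g h x E =
  `|\det (\matrix_(i < k, j < k) g (h x) (tangent_map h x (tnth e i)) (tnth e' j))|.
Proof.
move=> eE; have Ek : \dim E = k by rewrite (size_basis eE).
case: k / Ek e e' eE => e e' eE eE' se se' TE.
apply: (restr_absdet_orthonormal eE eE') => //.
apply/subvP => _ /memv_imgP[u uE ->]; rewrite lfunE; exact: TE.
Qed.

(** The supremum of a set of reals is an upper bound of this set only when the
    set is bounded. *)
Lemma restr_norm_has_ubound h x E :
  has_ubound [set tangent_norm g (h x) (tangent_map h x u) |
    u in [set u | u \in E /\ tangent_norm g x u <= 1]].
Proof.
have [w gw] := orthonormal_frame_exists (metric_ip g x).
exists (\sum_i ipnorm (metric_ip g (h x)) (tangent_map h x (tnth w i))).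
move=> _ [v [_ v1] <-].
rewrite (le_trans (ipnorm_linear_le (metric_ip g (h x)) _ v gw)) //.
rewrite -[leRHS]mulr1 ler_wpM2l // sumr_ge0 // => i _; exact: ipnorm_ge0.
Qed.

Lemma restr_norm_ge0 h x E : 0 <= restr_norm g h x E.
Proof.
rewrite -(ipnorm0 (metric_ip g (h x))) -(linear0 (tangent_map h x)).
apply: (ub_le_sup (restr_norm_has_ubound h x E)); exists 0 => //.
split; first exact: mem0v.
change (ipnorm (metric_ip g x) 0 <= 1).
by rewrite ipnorm0.
Qed.

Lemma restr_norm_le h x E u : u \in E ->
  ipnorm (metric_ip g (h x)) (tangent_map h x u) <=
  restr_norm g h x E * ipnorm (metric_ip g x) u.
Proof.
move=> uE; set s := metric_ip g x; set s' := metric_ip g (h x).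
have [->|u0] := eqVneq u 0; first by rewrite linear0 !ipnorm0 mulr0.
have su := ipnorm_gt0 s u0.
rewrite -ler_pdivrMr // mulrC -[leLHS](_ : ipnorm s'
  (tangent_map h x ((ipnorm s u)^-1 *: u)) = _); last first.
  by rewrite linearZ ipnormZ ger0_norm // invr_ge0 ltW.
apply: (ub_le_sup (restr_norm_has_ubound h x E)).
exists ((ipnorm s u)^-1 *: u) => //; split; first exact: memvZ.
change (ipnorm s ((ipnorm s u)^-1 *: u) <= 1).
by rewrite ipnormZ ger0_norm ?invr_ge0 ?ipnorm_ge0 // mulVf // gt_eqF.
Qed.

End RestrictedDerivative.

(** * Iterates of the derivative *)

Section Iterates.
Context {R : realType} {d : nat} {M : smooth_manifold R d}
  (g : riemannian_metric M) (f : C1_diffeo M).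
Implicit Types (x : M) (n : nat).

Lemma differentiable_diffeo_iter n x : differentiable_at_point (iter n f) x.
Proof.
apply: differentiable_at_point_iter => y.
exact/differentiable_at_point_C1/diffeo_C1.
Qed.

Lemma differentiable_diffeo_inv_iter n x :
  differentiable_at_point (iter n (diffeo_inv f)) x.
Proof.
apply: differentiable_at_point_iter => y.
exact/differentiable_at_point_C1/diffeo_inv_C1.
Qed.

Lemma tangent_iterD m n x u : tangent_map (iter (m + n) f) x u =
  tangent_map (iter m f) (iter n f x) (tangent_map (iter n f) x u).
Proof.
have -> : iter (m + n) f = iter m f \o iter n f.
  by apply/funext => y; rewrite iterD.
by apply: tangent_map_comp; exact: differentiable_diffeo_iter.
Qed.

Lemma tangent_iterS n x u : tangent_map (iter n.+1 f) x u =
  tangent_map f (iter n f x) (tangent_map (iter n f) x u).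
Proof. exact: (tangent_iterD 1). Qed.

Lemma iter_diffeoK n : cancel (iter n f) (iter n (diffeo_inv f)).
Proof. by elim: n => // n IH x; rewrite iterSr /= diffeoK IH. Qed.

Lemma tangent_iterK n x u :
  tangent_map (iter n (diffeo_inv f)) (iter n f x) (tangent_map (iter n f) x u)
  = u.
Proof.
rewrite -tangent_map_comp.
- have -> : iter n (diffeo_inv f) \o iter n f = id.
    by apply/funext => y /=; rewrite iter_diffeoK.
  exact: tangent_map_id.
- exact: differentiable_diffeo_iter.
- exact: differentiable_diffeo_inv_iter.
Qed.

Lemma iter_tangent_bound n : compact [set: M] ->
  exists2 K : R, 0 <= K & forall x u,
    ipnorm (metric_ip g (iter n f x)) (tangent_map (iter n f) x u) <=
      K * ipnorm (metric_ip g x) u /\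
    ipnorm (metric_ip g x) u <=
      K * ipnorm (metric_ip g (iter n f x)) (tangent_map (iter n f) x u).
Proof.
move=> cM; have [K K0 KP] := compact_tangent_bound g cM (diffeo_C1 f).
have [K' K'0 K'P] := compact_tangent_bound g cM (diffeo_inv_C1 f).
exists (Num.max K K' ^+ n); first by rewrite exprn_ge0 // le_max K0.
have m0 : 0 <= Num.max K K' by rewrite le_max K0.
elim: n => [|n IH] x u.
  by rewrite expr0 !mul1r (tangent_map_id x u).
pose v := tangent_map (iter n f) x u; pose y := iter n f x.
have [IH1 IH2] :
  ipnorm (metric_ip g y) v <= Num.max K K' ^+ n * ipnorm (metric_ip g x) u /\
  ipnorm (metric_ip g x) u <= Num.max K K' ^+ n * ipnorm (metric_ip g y) v :=
  IH x u.
have -> : tangent_map (iter n.+1 f) x u = tangent_map f y v := tangent_iterS n x u.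
change (iter n.+1 f x) with (f y).
clearbody v y; split.
  rewrite (le_trans (KP y v)) // exprS -mulrA.
  rewrite (le_trans (ler_wpM2r (ipnorm_ge0 _ _) (_ : K <= Num.max K K'))) //.
    by rewrite le_max lexx.
  by rewrite ler_wpM2l.
rewrite (le_trans IH2) // exprSr -mulrA ler_wpM2l ?exprn_ge0 //.
have vK : tangent_map (diffeo_inv f) (f y) (tangent_map f y v) = v :=
  tangent_iterK 1 y v.
have := K'P (f y) (tangent_map f y v); rewrite [X in ipnorm _ X]vK diffeoK.
move=> /le_trans; apply.
by rewrite ler_wpM2r ?ipnorm_ge0 // le_max lexx orbT.
Qed.

Lemma conservative_iter (omega : volume_form M) n x (A : 'M[R]_d) :
  conservative omega f ->
  omega (iter n f x) (\matrix_k tangent_map (iter n f) x (row k A)) = omega x A.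
Proof.
move=> cons; elim: n => [|n IH].
  congr (omega _ _); apply/row_matrixP => k; rewrite rowK.
  exact: (tangent_map_id x).
rewrite -IH -[RHS]cons; congr (omega _ _); apply/row_matrixP => k.
rewrite !rowK; exact: tangent_iterS.
Qed.

End Iterates.

(** * Dominated splittings *)

Section DominatedSplitting.
Context {R : realType} {d : nat} {M : smooth_manifold R d}
  (g : riemannian_metric M) (f : C1_diffeo M) (E F : M -> {vspace 'rV[R]_d}).

Lemma invariant_tangent_iter (U : M -> {vspace 'rV[R]_d}) n x :
  (forall y, (linfun (tangent_map f y) @: U y)%VS = U (f y)) ->
  (forall u, u \in U x -> tangent_map (iter n f) x u \in U (iter n f x)) /\
  (forall v, v \in U (iter n f x) ->
    exists2 u, u \in U x & tangent_map (iter n f) x u = v).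
Proof.
move=> Uf; elim: n => [|n [IH1 IH2]].
  have idx u : tangent_map (iter 0 f) x u = u := tangent_map_id x u.
  by split=> [u uU|u uU]; [rewrite idx|exists u].
split=> [u uU|v vU].
  have -> : tangent_map (iter n.+1 f) x u =
    tangent_map f (iter n f x) (tangent_map (iter n f) x u) := tangent_iterS f n x u.
  by rewrite iterS -Uf -[tangent_map f _ _]lfunE memv_img // IH1.
move: vU; rewrite iterS -Uf => /memv_imgP[w wU ->]; rewrite lfunE.
by have [u uU <-] := IH2 w wU; exists u => //; exact: tangent_iterS.
Qed.

(** Domination at time n and point x with constant c, where a bounds the norm
    along E and 1 / b bounds the conorm along F. In terms of arbitrary bounds a
    and b and of the forward derivative alone, it composes along orbits. *)
Definition dominated_by n (c : R) x : Prop := exists a b : R,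
  [/\ 0 <= a, 0 <= b, a * b <= c,
    forall u, u \in E x ->
      ipnorm (metric_ip g (iter n f x)) (tangent_map (iter n f) x u) <=
      a * ipnorm (metric_ip g x) u &
    forall v, v \in F x -> ipnorm (metric_ip g x) v <=
      b * ipnorm (metric_ip g (iter n f x)) (tangent_map (iter n f) x v)].

Hypothesis Ef : forall y, (linfun (tangent_map f y) @: E y)%VS = E (f y).
Hypothesis Ff : forall y, (linfun (tangent_map f y) @: F y)%VS = F (f y).

Lemma dominated_by_restr_norm n x c :
  restr_norm g (iter n f) x (E x) *
  restr_norm g (iter n (diffeo_inv f)) (iter n f x) (F (iter n f x)) < c ->
  dominated_by n c x.
Proof.
set a := restr_norm g (iter n f) x (E x).
set b := restr_norm g _ (iter n f x) _ => abc.
exists a, b; split; [exact: restr_norm_ge0|exact: restr_norm_ge0|exact: ltW| |].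
  by move=> u uE; exact: restr_norm_le.
move=> v vF; have [+ _] := invariant_tangent_iter n x Ff => /(_ v vF) TvF.
have := restr_norm_le g (iter n (diffeo_inv f)) (iter n f x) TvF.
by rewrite [X in ipnorm _ X](tangent_iterK f n x v) iter_diffeoK.
Qed.

Lemma dominated_by_iter n c k x :
  (forall y, dominated_by n c y) -> dominated_by (n * k) (c ^+ k) x.
Proof.
move=> dom; elim: k x => [|k IH] x.
  rewrite muln0; exists 1, 1; split=> //; first by rewrite mulr1 expr0.
    by move=> u _; rewrite mul1r [X in ipnorm _ X](tangent_map_id x u).
  by move=> u _; rewrite mul1r [X in _ <= ipnorm _ X](tangent_map_id x u).
rewrite mulnSr; set m := (n * k)%N in IH *.
have [a [b [a0 b0 abc aE bF]]] := dom x.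
have [a' [b' [a'0 b'0 abc' aE' bF']]] := IH (iter n f x).
have TD u : ipnorm (metric_ip g (iter (m + n) f x)) (tangent_map (iter (m + n) f) x u)
    = ipnorm (metric_ip g (iter m f (iter n f x)))
        (tangent_map (iter m f) (iter n f x) (tangent_map (iter n f) x u)).
  by rewrite iterD [X in ipnorm _ X](tangent_iterD f m n x u).
have [TE _] := invariant_tangent_iter n x Ef.
have [TF _] := invariant_tangent_iter n x Ff.
exists (a' * a), (b' * b); split; [exact: mulr_ge0|exact: mulr_ge0| | |].
- by rewrite mulrACA exprSr ler_pM ?mulr_ge0.
- move=> u uE; rewrite TD (le_trans (aE' _ (TE u uE))) //.
  by rewrite -mulrA ler_wpM2l // aE.
- move=> v vF; rewrite TD (le_trans (bF v vF)) // [b' * b]mulrC -mulrA.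
  by rewrite ler_wpM2l // bF' // TF.
Qed.

End DominatedSplitting.
(** The dimension of M is written p + q, so that frames adapted to the splitting
    are square block matrices. *)
Section VolumeOfSplitting.
Context {R : realType} {p q : nat} {M : smooth_manifold R (p + q)}
  (g : riemannian_metric M) (f : C1_diffeo M)
  (E F : M -> {vspace 'rV[R]_(p + q)}).
Hypothesis compactM : compact [set: M].
Hypothesis EF : forall x, (E x + F x)%VS = fullv.
Hypothesis dimE : forall x, \dim (E x) = p.
Hypothesis dimF : forall x, \dim (F x) = q.
Hypothesis Ef : forall x, (linfun (tangent_map f x) @: E x)%VS = E (f x).
Hypothesis Ff : forall x, (linfun (tangent_map f x) @: F x)%VS = F (f x).

Lemma dominated_volume_bounds N x c : dominated_by g f E F N c x ->
  exists a b : R, [/\ 0 <= a, 0 <= b, a * b <= c,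
    restr_absdet g (iter N f) x (E x) <= p`!%:R * a ^+ p &
    1 <= q`!%:R * b ^+ q * restr_absdet g (iter N f) x (F x)].
Proof.
move=> [a [b [a0 b0 abc aE bF]]]; exists a, b.
have [TE _] := invariant_tangent_iter N x Ef.
have [TF TF_onto] := invariant_tangent_iter N x Ff.
have [e [eE se]] := orthonormal_basis_exists (metric_ip g x) (dimE x).
have [e' [eE' se']] :=
  orthonormal_basis_exists (metric_ip g (iter N f x)) (dimE (iter N f x)).
have [h [hF sh]] := orthonormal_basis_exists (metric_ip g x) (dimF x).
have [h' [hF' sh']] :=
  orthonormal_basis_exists (metric_ip g (iter N f x)) (dimF (iter N f x)).
split=> //.
  rewrite (restr_absdet_basis eE eE' se se' TE).
  apply: (orthonormal_det_le se se') => i.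
  by apply: aE; apply: (basis_mem eE); exact: mem_tnth.
rewrite (restr_absdet_basis hF hF' sh sh' TF).
exact: (orthonormal_det_ge hF hF' sh sh' TF_onto b0 bF).
Qed.

Lemma dominated_transverse n : (forall x, dominated_by g f E F n (1 / 2) x) ->
  exists2 C : R, 1 <= C & forall x u v, u \in E x -> v \in F x ->
    ipnorm (metric_ip g x) u <= C * ipnorm (metric_ip g x) (u + v) /\
    ipnorm (metric_ip g x) v <= C * ipnorm (metric_ip g x) (u + v).
Proof.
move=> dom; have [K K0 KP] := iter_tangent_bound g f n compactM.
exists (1 + 4 * K ^+ 2); first by rewrite lerDl mulr_ge0 ?sqr_ge0.
move=> x u v uE vF; have [a [b [a0 b0 ab aE bF]]] := dom x.
apply: (transverse_of_domination (T := tangent_map (iter n f) x)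
  (s' := metric_ip g (iter n f x)) _ _ K0 b0 ab (aE u uE) (bF v vF)).
- by move=> z; have [] := KP x z.
- by move=> z; have [] := KP x z.
Qed.

Variable omega : volume_form M.
Hypothesis f_conservative : conservative omega f.

(** Conservation of omega: the product of the volume factors along E and F is a
    quotient of volumes of frames adapted to the splitting, all of them
    comparable to 1. *)
Lemma dominated_absdet_product n : (forall x, dominated_by g f E F n (1 / 2) x) ->
  exists2 L : R, 0 < L & forall N x,
    let XY := restr_absdet g (iter N f) x (E x) *
              restr_absdet g (iter N f) x (F x) in
    XY <= L /\ 1 <= L * XY.
Proof.
move=> dom; have [C C1 CP] := dominated_transverse dom.
have [D D0 DP] := compact_density_bounds g omega compactM.
pose L := (p + q)`!%:R * C ^+ (p + q) * D.
have C0 : 0 < C by rewrite (lt_le_trans ltr01).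
have fact0 : 0 < (p + q)`!%:R :> R by rewrite ltr0n fact_gt0.
have L0 : 0 < L by rewrite !mulr_gt0 ?exprn_gt0.
have frame_vol x (e : p.-tuple 'rV[R]_(p + q)) (h : q.-tuple 'rV[R]_(p + q)) :
    basis_of (E x) e -> orthonormal (metric_ip g x) e ->
    basis_of (F x) h -> orthonormal (metric_ip g x) h ->
    `|omega x (col_mx (frame e) (frame h))| <= L /\
    1 <= L * `|omega x (col_mx (frame e) (frame h))|.
  move=> eE se hF sh; have [w sw] := orthonormal_frame_exists (metric_ip g x).
  have [wD Dw] := DP x w sw.
  have [/= A1 A2] := splitting_frame_bounds eE se hF sh sw (EF x) (CP x).
  rewrite (frame_expand (col_mx (frame e) (frame h)) sw).
  rewrite volume_form_mulmx normrM; set t := `|\det _| in A1 A2 *.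
  set v := `|omega x _| in wD Dw *; split.
    rewrite ler_pM ?normr_ge0 // (le_trans A1) // ler_peMr ?(ltW fact0) //.
    by rewrite exprn_ege1.
  have -> : L * (t * v) = ((p + q)`!%:R * C ^+ (p + q) * t) * (D * v).
    by rewrite /L; ring.
  by rewrite -[leLHS]mulr1 ler_pM.
exists (L ^+ 2) => [|N x XY]; first exact: exprn_gt0.
have [TE _] := invariant_tangent_iter N x Ef.
have [TF _] := invariant_tangent_iter N x Ff.
have [e [eE se]] := orthonormal_basis_exists (metric_ip g x) (dimE x).
have [e' [eE' se']] :=
  orthonormal_basis_exists (metric_ip g (iter N f x)) (dimE (iter N f x)).
have [h [hF sh]] := orthonormal_basis_exists (metric_ip g x) (dimF x).
have [h' [hF' sh']] :=
  orthonormal_basis_exists (metric_ip g (iter N f x)) (dimF (iter N f x)).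
have [P1 P2] := frame_vol x e h eE se hF sh.
have [Q1 Q2] := frame_vol (iter N f x) e' h' eE' se' hF' sh'.
have XYE : `|omega x (col_mx (frame e) (frame h))| =
    XY * `|omega (iter N f x) (col_mx (frame e') (frame h'))|.
  rewrite -(conservative_iter N x _ f_conservative).
  rewrite (splitting_map_block eE eE' se' hF hF' sh' TE TF).
  rewrite volume_form_mulmx det_ublock !normrM /XY.
  by rewrite (restr_absdet_basis eE eE' se se' TE)
    (restr_absdet_basis hF hF' sh sh' TF).
have XY0 : 0 <= XY.
  by rewrite mulr_ge0 // divr_ge0 // sqrtr_ge0.
rewrite XYE in P1 P2; set v := `|omega (iter N f x) _| in P1 P2 Q1 Q2.
split.
  rewrite -[XY]mulr1 (le_trans (ler_wpM2l XY0 Q2)) // mulrCA expr2.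
  by rewrite ler_wpM2l // ltW.
rewrite (le_trans P2) // expr2 -mulrA ler_wpM2l ?(ltW L0) // mulrC.
by rewrite ler_wpM2r.
Qed.

End VolumeOfSplitting.

(** * Uniform contraction and expansion *)

Lemma exp_half_small (R : realType) (C e : R) : 0 < e ->
  exists k, C * (1 / 2) ^+ k.+1 < e.
Proof.
move=> e0; have [C0|C0] := leP C 0.
  by exists 0%N; rewrite (le_lt_trans _ e0) // mulr_le0_ge0 ?exprn_ge0.
pose k := Num.truncn (C / e); exists k.
have Ck : C / e < k.+1%:R by rewrite truncnS_gt.
have k2 : k.+1%:R <= 2 ^+ k.+1 :> R.
  by rewrite -natrX ler_nat ltnW // ltn_expl.
rewrite div1r exprVn ltr_pdivrMr ?exprn_gt0 // mulrC -ltr_pdivrMr //.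
exact: lt_le_trans Ck k2.
Qed.

Section UniformContraction.
Context {R : realType} {p q : nat} {M : smooth_manifold R (p + q)}
  (g : riemannian_metric M) (f : C1_diffeo M)
  (E F : M -> {vspace 'rV[R]_(p + q)}) (omega : volume_form M).
Hypothesis p_gt0 : (0 < p)%N.
Hypothesis q_gt0 : (0 < q)%N.
Hypothesis compactM : compact [set: M].
Hypothesis EF : forall x, (E x + F x)%VS = fullv.
Hypothesis dimE : forall x, \dim (E x) = p.
Hypothesis dimF : forall x, \dim (F x) = q.
Hypothesis Ef : forall x, (linfun (tangent_map f x) @: E x)%VS = E (f x).
Hypothesis Ff : forall x, (linfun (tangent_map f x) @: F x)%VS = F (f x).
Hypothesis f_conservative : conservative omega f.

Lemma dominated_contracts_expands n :
  (forall x, dominated_by g f E F n (1 / 2) x) ->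
  exists k, forall x,
    restr_absdet g (iter (n * k.+1) f) x (E x) < 1 / 2 /\
    2 < restr_absdet g (iter (n * k.+1) f) x (F x).
Proof.
move=> dom.
have [L L0 LP] := dominated_absdet_product compactM EF dimE dimF Ef Ff
  f_conservative dom.
(* The second bound on X forces Y > 2, since 1 <= L * (X * Y). *)
pose e := Num.min (1 / 2) (1 / (2 * L)).
have e0 : 0 < e by rewrite lt_min !divr_gt0 ?mulr_gt0.
have [k kP] := exp_half_small (p`!%:R ^+ q * q`!%:R ^+ p * L ^+ p)
  (exprn_gt0 (p + q) e0).
exists k => x; set N := (n * k.+1)%N.
have [a [b [a0 b0 ab Xa Yb]]] := dominated_volume_bounds dimE dimF Ef Ff
  (dominated_by_iter Ef Ff k.+1 x dom).
have [XYL LXY] := LP N x; rewrite -/N in Xa Yb.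
set X := restr_absdet g _ x (E x) in Xa XYL LXY *.
set Y := restr_absdet g _ x (F x) in Yb XYL LXY *.
have X0 : 0 <= X by rewrite divr_ge0 ?sqrtr_ge0.
have Y0 : 0 <= Y by rewrite divr_ge0 ?sqrtr_ge0.
have half1 : (1 / 2 : R) ^+ k.+1 <= 1 by rewrite exprn_ile1 //; lra.
have Xe : X < e.
  rewrite -(ltr_pXn2r (n := p + q)) ?nnegrE ?addn_gt0 ?p_gt0 // ?ltW //.
  have := domination_volume_bound X0 Y0 a0 b0 (ler0n _ _) (ler0n _ _) Xa Yb XYL.
  move=> /le_lt_trans; apply; apply: le_lt_trans kP.
  rewrite ler_wpM2l ?mulr_ge0 ?exprn_ge0 ?(ltW L0) // (le_trans _ ab) //.
  by rewrite ler_iXnr ?muln_gt0 ?p_gt0 ?mulr_ge0 // (le_trans ab).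
move: Xe; rewrite lt_min => /andP[X2 XL]; split=> //.
rewrite ltNge; apply/negP => Y2; move: LXY; apply/negP; rewrite -ltNge.
rewrite ltr_pdivlMr ?mulr_gt0 // in XL.
have LX0 : 0 <= L * X by rewrite mulr_ge0 // ltW.
by nra.
Qed.

(** At time 0 the derivative is the identity, so that a and b are at least 1. *)
Lemma dominated_by_gt0 n x : dominated_by g f E F n (1 / 2) x -> (0 < n)%N.
Proof.
case: n => // -[a [b [a0 b0 ab aE bF]]].
have idx u : tangent_map (iter 0 f) x u = u := tangent_map_id x u.
have E0 : E x != 0%VS by rewrite -dimv_eq0 dimE -lt0n.
have F0 : F x != 0%VS by rewrite -dimv_eq0 dimF -lt0n.
have gE : 0 < ipnorm (metric_ip g x) (vpick (E x)).
  by rewrite ipnorm_gt0 // vpick0.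
have gF : 0 < ipnorm (metric_ip g x) (vpick (F x)).
  by rewrite ipnorm_gt0 // vpick0.
have := aE _ (memv_pick (E x)).
rewrite [X in ipnorm _ X <= _]idx ler_pMl // => a1.
have := bF _ (memv_pick (F x)).
rewrite [X in _ <= _ * ipnorm _ X]idx ler_pMl // => b1.
by nra.
Qed.

End UniformContraction.

Theorem proposition0p5 (R : realType) (d : nat) (M : smooth_manifold R d)
    (compactM : compact [set: M])
    (omega : volume_form M) (g : riemannian_metric M)
    (f : C1_diffeo M) (f_conservative : conservative omega f)
    (E F : M -> {vspace 'rV[R]_d})
    (EF_dominated : dominated_splitting g f E F) :
  contracts_volume g f E /\ expands_volume g f F.
Proof.
(* The equation d = p + q is read off at a point of M. *)
have [[x0 _]|M0] := pselect (exists x : M, True); last first.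
  by split; exists 1%N => // x; case: M0; exists x.
case: EF_dominated => EF [p [q [p0 q0 dimEF]]] EFf [n dom].
have dpq : d = (p + q)%N.
  have [<- <-] := dimEF x0; have [EFx0 EF0] := EF x0.
  by rewrite -dimv_sum_cap EFx0 EF0 dimv0 addn0 dimvf dim_matrix mul1r.
subst d.
have Ef x := (EFf x).1; have Ff x := (EFf x).2.
have dimE x := (dimEF x).1; have dimF x := (dimEF x).2.
have dom' x : dominated_by g f E F n (1 / 2) x.
  exact: dominated_by_restr_norm.
have n0 := dominated_by_gt0 p0 q0 dimE dimF (dom' x0).
have [k kP] := dominated_contracts_expands p0 q0 compactM (fun x => (EF x).1)
  dimE dimF Ef Ff f_conservative dom'.
have l0 : (1 <= n * k.+1)%N by rewrite muln_gt0 n0.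
by split; exists (n * k.+1)%N => // x; case: (kP x).
Qed.
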